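(* Let $K$ be a field, $S=K[x_1,\ldots,x_n]$ the standard graded polynomial ring, $I\subsetneq S$ a graded ideal, and $\mathfrak{p}\in\mathrm{Ass}(I)$ an associated prime of $I$ generated by linear forms. Then the following hold. (1) If $S/I$ is Gorenstein, then $\mathrm{v}_{\mathfrak{p}}(I)=\mathrm{reg}(S/I)$. (2) If $S/I$ is level, then $\mathrm{v}_{\mathfrak{p}}(I)\geq \mathrm{reg}(S/I)$. More specifically, if all the associated primes of $I$ are generated by linear forms (for example, if $I$ is a monomial ideal), then $\mathrm{v}_{\mathfrak{p}}(I)$ can be replaced by $\mathrm{v}(I)$ in (1) and (2): $\mathrm{v}(I)=\mathrm{reg}(S/I)$ if $S/I$ is Gorenstein, and $\mathrm{v}(I)\geq\mathrm{reg}(S/I)$ if $S/I$ is level.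
   Context: $S_d$ denotes the degree-$d$ component of $S=\bigoplus_{d\ge 0}S_d$. $\mathrm{Ass}(I)$ denotes the set of associated primes of $S/I$; for a proper graded ideal $I$ these are exactly the prime ideals of the form $I:f$ with $f$ homogeneous. For a proper graded ideal $I$ and $\mathfrak{p}\in\mathrm{Ass}(I)$, the local v-number is $\mathrm{v}_{\mathfrak{p}}(I)=\min\{d\ge 0 \mid \exists f\in S_d \text{ with } I:f=\mathfrak{p}\}$, and the v-number is $\mathrm{v}(I)=\min\{\mathrm{v}_{\mathfrak{p}}(I)\mid \mathfrak{p}\in\mathrm{Ass}(I)\}$. Let $R=S/I$ have minimal graded free resolution $0\to F_c\to\cdots\to F_1\to F_0\to 0$ over $S$ with $F_i=\bigoplus_j S(-j)^{\beta_{i,j}}$. The Castelnuovo-Mumford regularity is $\mathrm{reg}(R)=\max\{j-i\mid \beta_{i,j}\ne 0\}$. When $R$ is Cohen-Macaulay, its canonical module is $\omega_R=\mathrm{Ext}^c_S(R,S)$, where $c$ is the projective dimension of $R$. The ring $R$ is Gorenstein if it is Cohen-Macaulay and $\omega_R$ is generated by a single element (equivalently $F_c=S(-(c+\mathrm{reg}R))$). The ring $R$ is level if it is Cohen-Macaulay and all elements of a minimal homogeneous generating set of $\omega_R$ have the same degree (equivalently $F_c=S(-(c+\mathrm{reg}R))^{\beta}$ for some $\beta\ge 1$). *)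

(* Defs.v *)
From HB Require Import structures.
From mathcomp Require Import all_boot all_order all_algebra.
From mathcomp.multinomials Require Export mpoly.
Set Implicit Arguments.
Unset Strict Implicit.
Unset Printing Implicit Defensive.
Import GRing.Theory.
Local Open Scope ring_scope.

(* Ideals of S = {mpoly K[n]} are boolean predicates.  The library predicate  *)
(* [idealr_closed I] already contains the properness condition [1 \notin I],  *)
(* and hence so do prime ideals below.  The numerical invariants that are     *)
(* minima, maxima or suprema (v-number, depth, Krull dimension) are given as  *)
(* relations "d is the value of the invariant", never by a default value.     *)

Definition is_min (P : nat -> Prop) (d : nat) : Prop :=
  P d /\ forall e, P e -> (d <= e)%N.

Definition is_max (P : nat -> Prop) (d : nat) : Prop :=
  P d /\ forall e, P e -> (e <= d)%N.

Section Ideals.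
Variables (K : fieldType) (n : nat).
Local Notation S := {mpoly K[n]}.
Implicit Types (I p : {pred S}) (G : S -> Prop).

Definition graded_ideal I : Prop :=
  idealr_closed I /\ forall f d, f \in I -> pihomog mdeg d f \in I.

Definition prime_ideal p : Prop := idealr_closed p /\ prime_idealr_closed p.

Definition ideal_gen G (f : S) : Prop :=
  exists (r : nat) (a g : 'I_r -> S),
    (forall k, G (g k)) /\ f = \sum_(k < r) a k * g k.

Definition generated_by_linear_forms p : Prop :=
  exists G, (forall g, G g -> g \is 1.-homog) /\
            forall f, f \in p <-> ideal_gen G f.

Definition monomial_ideal I : Prop :=
  exists M : 'X_{1..n} -> Prop,
    forall f, f \in I <-> ideal_gen (fun g => exists2 m, M m & g = 'X_[m]) f.

Definition colon I (f : S) : {pred S} := [pred g | g * f \in I].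

Definition associated_prime I p : Prop :=
  prime_ideal p /\ exists f, colon I f =i p.

Definition is_local_vnumber I p : nat -> Prop :=
  is_min (fun d => exists2 f : S, f \is d.-homog & colon I f =i p).

Definition is_vnumber I : nat -> Prop :=
  is_min (fun d => exists2 p, associated_prime I p & is_local_vnumber I p d).

Definition prime_chain I (d : nat) : Prop :=
  exists P : nat -> {pred S},
    (forall i, (i <= d)%N -> prime_ideal (P i) /\ {subset I <= P i}) /\
    (forall i, (i < d)%N -> {subset P i <= P i.+1} /\ ~ (P i =i P i.+1)).

Definition is_krull_dim I : nat -> Prop := is_max (prime_chain I).

(* The ideal (I, t_0, ..., t_{i-1}). *)
Definition ideal_adjoin I (t : nat -> S) (i : nat) : S -> Prop :=
  ideal_gen (fun g => g \in I \/ exists2 j, (j < i)%N & g = t j).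

Definition has_regular_sequence I (d : nat) : Prop :=
  exists t : nat -> S,
    [/\ forall i, (i < d)%N -> exists2 e, (0 < e)%N & t i \is e.-homog,
        forall i, (i < d)%N -> forall f,
          ideal_adjoin I t i (t i * f) -> ideal_adjoin I t i f
      & ~ ideal_adjoin I t d 1].

Definition is_depth I : nat -> Prop := is_max (has_regular_sequence I).

Definition cohen_macaulay I : Prop :=
  exists2 d, is_depth I d & is_krull_dim I d.

End Ideals.

(* [fdiff i] is the matrix of F_{i+1} -> F_i acting on row vectors by         *)
(* [v |-> v *m fdiff i], where F_i = \bigoplus_(k < frank i) S(-fshift k);    *)
(* [faug] is the matrix of a lift F_0 -> S of the augmentation F_0 -> S/I.    *)
Record graded_free_seq (K : fieldType) (n : nat) := GradedFreeSeq {
  flen : nat;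
  frank : nat -> nat;
  fshift : forall i, 'I_(frank i) -> nat;
  fdiff : forall i, 'M[{mpoly K[n]}]_(frank i.+1, frank i);
  faug : 'M[{mpoly K[n]}]_(frank 0, 1)
}.
Arguments fshift {K n} _ {i} k.
Arguments faug {K n} _.

Section Resolutions.
Variables (K : fieldType) (n : nat).
Local Notation S := {mpoly K[n]}.
Implicit Types (I : {pred S}) (F : graded_free_seq K n).

Record minimal_graded_free_resolution I F : Prop := {
  mres_len : (0 < frank F (flen F))%N;
  mres_finite : forall i, (flen F < i)%N -> frank F i = 0%N;
  mres_aug_homog : forall k, faug F k 0 \is (fshift F k).-homog;
  mres_diff_homog : forall i k l, fdiff F i k l != 0 ->
    exists2 e, fshift F k = (fshift F l + e)%N & fdiff F i k l \is e.-homog;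
  mres_aug_surj : forall f : S,
    exists v : 'rV_(frank F 0), f - (v *m faug F) 0 0 \in I;
  mres_exact0 : forall v : 'rV_(frank F 0),
    (v *m faug F) 0 0 \in I <-> exists w, v = w *m fdiff F 0;
  mres_exact : forall i (v : 'rV_(frank F i.+1)),
    v *m fdiff F i = 0 <-> exists w, v = w *m fdiff F i.+1;
  mres_minimal : forall i k l, (fdiff F i k l)@_0%MM = 0
}.

Definition betti F (i j : nat) : nat :=
  #|[set k : 'I_(frank F i) | fshift F k == j]|.

(* The maximum of j - i over the pairs (i, j) with [betti F i j != 0].        *)
(* Truncated subtraction is harmless: the pair (0, 0) always occurs in the    *)
(* minimal resolution of some S/I with I proper, so the maximum is >= 0.      *)
Definition regularity F : nat :=
  \max_(i < (flen F).+1)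
    \max_(j < (\max_(k < frank F i) fshift F k).+1 | betti F i j != 0%N) (j - i)%N.

(* Hom(F_i, S) is the module of column vectors of height [frank F i], and the *)
(* coboundary Hom(F_i, S) -> Hom(F_{i+1}, S) is [x |-> fdiff F i *m x].       *)
(* Ext^i_S(S/I, S) is cocycles modulo coboundaries.                           *)
Definition ext_cocycle F i (x : 'cV[S]_(frank F i)) : Prop :=
  fdiff F i *m x = 0.

Definition ext_coboundary F i : 'cV[S]_(frank F i) -> Prop :=
  match i with
  | 0%N => fun x => x = 0
  | j.+1 => fun x => exists y, x = fdiff F j *m y
  end.

(* The basis vector of Hom(F_i, S) dual to the k-th one has degree            *)
(* [- fshift F k], so degrees in Ext are integers.                            *)
Definition ext_homog F i (d : int) (x : 'cV[S]_(frank F i)) : Prop :=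
  forall k, x k 0 != 0 ->
    exists2 e : nat, e%:Z = d + (fshift F k)%:Z & x k 0 \is e.-homog.

(* The classes of the x_k with k \in J generate Ext^i_S(S/I, S). *)
Definition ext_generated F i m (x : 'I_m -> 'cV[S]_(frank F i))
    (J : {set 'I_m}) : Prop :=
  (forall k, k \in J -> ext_cocycle (x k)) /\
  forall y, ext_cocycle y -> exists a : 'I_m -> S,
    ext_coboundary (y - \sum_(k in J) a k *: x k).

(* Below, F is a minimal graded free resolution of S/I, so that [flen F] is   *)
(* the projective dimension c of S/I and the canonical module is Ext^c.       *)

Definition gorenstein I F : Prop :=
  cohen_macaulay I /\
  exists x : 'I_1 -> 'cV[S]_(frank F (flen F)), ext_generated x setT.

Definition level I F : Prop :=
  cohen_macaulay I /\
  exists m (x : 'I_m -> 'cV[S]_(frank F (flen F))) (d : int),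
    [/\ ext_generated x setT,
        forall k, ~ ext_generated x [set~ k]
      & forall k, ext_homog d (x k)].

End Resolutions.

(* Main.v *)
Require Import Defs.
From HB Require Import structures.
From mathcomp Require Import all_boot all_order all_algebra.
From mathcomp Require Import boolp ring zify.
Set Implicit Arguments.
Unset Strict Implicit.
Unset Printing Implicit Defensive.
Import Order.POrderTheory Order.JoinTheory GRing.Theory.
Local Open Scope ring_scope.

(** Let [F] be the minimal resolution of [S/I], of length [c], and let
    [p = (l_1, ..., l_h)] be an associated prime, with independent linear forms
    [l_i].  Computing [Tor_h(S/p, S/I)] from the Koszul resolution of [S/p] gives
    [(I : p)/I], up to a shift by [h]; computing it from [F] gives the cycles
    modulo boundaries of [F/pF] in homological degree [h].  If [h = c], the
    latter is the kernel of [F_c/pF_c -> F_{c-1}/pF_{c-1}].  Hence an element [f]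
    of degree [d] with [I : f = p] corresponds to a nonzero vector of degree
    [d + c] in [F_c/pF_c].  If all shifts of [F_c] equal [s], which is what level
    means, then [d + c >= s] ([shift_le_degree]).  If moreover [F_c] has rank
    one, the existence of this vector forces the last differential to vanish
    modulo [p], so the generator of [F_c] is itself such a vector and comes from
    an element of degree [s - c] ([gorenstein_witness]).  It remains to see that
    [h = c] and that [s - c] is the regularity.

    The correspondence is set up without Koszul complexes: [koszul_rel] adds the
    [l_i] one at a time and composes the connecting maps
    [Tor_{i+1}(S/p_{i+1}, S/I) -> Tor_i(S/p_i, S/I)], where
    [p_i = (l_1, ..., l_i)].  They are injective with image the [l_{i+1}]-torsion
    because [Tor_i(S/p_j, S/I) = 0] for [i > j], which has a short direct proof
    ([tor_vanishing]).

    For [h = c], let [d] be both the depth and the dimension of [S/I].  The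
    correspondence shows that [h <= c], as [F_h] must not vanish
    ([height_le_flen]).  Iterating the mapping cone along a homogeneous regular
    sequence [t] of length [d] yields a minimal resolution of length [c + d], so
    [c + d <= n] by the syzygy theorem ([flen_add_depth]).  Finally
    [n - h <= d], by the chain of primes obtained by adding linear forms to [p].

    For the regularity, the shifts must grow strictly along [F], that is, no
    column of a differential may vanish; this follows from
    [Ext^i(S/I, S) = 0] for [i < c].  Zero columns persist in the iterated cone,
    which resolves [S/J] with [J = (I, t)].  As the length of [t] is the
    dimension, [J] contains powers of all the variables
    ([artinian_reduction]); these form a regular sequence of length [n], whence
    [Ext^i(S/J, S) = 0] for [i < n] ([ext_vanishing]).  The primes needed in the
    Artinian reduction, and the existence of an associated prime, come from the
    ascending chain condition ([noetherian]), proved with Dickson's lemma.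

    For a monomial ideal, the leading monomial of an element of an associated
    prime is again in that prime, so the prime is generated by variables
    ([monomial_associated_prime]). *)

(** * Ideals and regular sequences *)

Section IdealTheory.
Variable R : comNzRingType.
Implicit Types (J P : R -> Prop) (t : nat -> R).

Definition is_ideal J : Prop :=
  J 0 /\ forall a x y, J x -> J y -> J (a * x + y).

Definition zero_ideal (f : R) : Prop := f = 0.

(** The ideal [(J, t_0, ..., t_{i-1})].  It is encoded by recursion because every
    induction below adds one generator at a time. *)
Fixpoint adjoin J t (i : nat) (f : R) : Prop :=
  if i is j.+1 then exists b, adjoin J t j (f - b * t j) else J f.

Definition regular_sequence J t (h : nat) : Prop :=
  forall i, (i < h)%N -> forall f, adjoin J t i (t i * f) -> adjoin J t i f.

Lemma is_ideal_zero : is_ideal zero_ideal.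
Proof. by split=> // a x y; rewrite /zero_ideal => -> ->; rewrite mulr0 addr0. Qed.

Section Closure.
Variable J : R -> Prop.
Hypothesis idJ : is_ideal J.

Lemma ideal0 : J 0. Proof. by case: idJ. Qed.

Lemma ideal_mul a x : J x -> J (a * x).
Proof. by move=> Jx; have [J0 /(_ a x 0 Jx J0)] := idJ; rewrite addr0. Qed.

Lemma ideal_mulr a x : J x -> J (x * a).
Proof. by rewrite mulrC; apply: ideal_mul. Qed.

Lemma idealD x y : J x -> J y -> J (x + y).
Proof. by move=> Jx Jy; have [_ /(_ 1 x y Jx Jy)] := idJ; rewrite mul1r. Qed.

Lemma idealN x : J x -> J (- x).
Proof. by rewrite -mulN1r; apply: ideal_mul. Qed.

Lemma idealB x y : J x -> J y -> J (x - y).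
Proof. by move=> Jx /idealN; apply: idealD. Qed.

Lemma ideal_eqD x y : J (x - y) -> J y -> J x.
Proof. by move=> Jxy /(idealD Jxy); rewrite subrK. Qed.

Lemma ideal_eqDr x y : J (x - y) -> J x -> J y.
Proof. by move=> Jxy Jx; have := idealB Jx Jxy; rewrite opprB addrC subrK. Qed.

Lemma ideal_sum (T : Type) (r : seq T) (Q : pred T) (F : T -> R) :
  (forall i, Q i -> J (F i)) -> J (\sum_(i <- r | Q i) F i).
Proof. exact: (big_ind _ ideal0 idealD). Qed.

End Closure.

Lemma is_ideal_adjoin J t i : is_ideal J -> is_ideal (adjoin J t i).
Proof.
move=> idJ; elim: i => [|i IH] //=; split=> [|a x y [b Hb] [c Hc]].
  by exists 0; rewrite mul0r subr0; apply: ideal0.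
exists (a * b + c).
have -> : a * x + y - (a * b + c) * t i = a * (x - b * t i) + (y - c * t i).
  by rewrite mulrDl mulrBr opprD addrACA mulrA.
by apply: idealD => //; apply: ideal_mul.
Qed.

Lemma adjoinS J t i f : is_ideal J -> adjoin J t i f -> adjoin J t i.+1 f.
Proof. by exists 0; rewrite mul0r subr0. Qed.

Lemma adjoin_le J t i j f : is_ideal J -> (i <= j)%N ->
  adjoin J t i f -> adjoin J t j f.
Proof.
move=> idJ /subnK <-; elim: (j - i)%N => [|k IH] // /IH.
exact: adjoinS.
Qed.

Lemma adjoin_base J t i f : is_ideal J -> J f -> adjoin J t i f.
Proof. by move=> idJ; apply: (@adjoin_le J t 0). Qed.

Lemma adjoin_gen J t i j : is_ideal J -> (j < i)%N -> adjoin J t i (t j).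
Proof.
move=> idJ lt_ji; apply: (adjoin_le idJ lt_ji) => /=.
by exists 1; rewrite mul1r subrr; apply: ideal0; apply: is_ideal_adjoin.
Qed.

Lemma adjoin_sub J P t i : is_ideal P -> (forall f, J f -> P f) ->
  (forall j, (j < i)%N -> P (t j)) -> forall f, adjoin J t i f -> P f.
Proof.
move=> idP JP; elim: i => [|i IH] Pt f /=; first exact: JP.
move=> [b Hb]; apply: (ideal_eqD idP (y := b * t i)).
  by apply: IH Hb => j lt_ji; apply: Pt; apply: ltnW.
by apply: ideal_mul => //; apply: Pt.
Qed.

Definition mx_in P m n (A : 'M[R]_(m, n)) : Prop := forall i j, P (A i j).

Section MatrixIdeal.
Variable J : R -> Prop.
Hypothesis idJ : is_ideal J.

Lemma mx_in0 m n : mx_in J (0 : 'M_(m, n)).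
Proof. by move=> i j; rewrite mxE; apply: ideal0. Qed.

Lemma mx_inD m n (A B : 'M_(m, n)) : mx_in J A -> mx_in J B -> mx_in J (A + B).
Proof. by move=> HA HB i j; rewrite mxE; apply: idealD. Qed.

Lemma mx_inN m n (A : 'M_(m, n)) : mx_in J A -> mx_in J (- A).
Proof. by move=> HA i j; rewrite mxE; apply: idealN. Qed.

Lemma mx_inB m n (A B : 'M_(m, n)) : mx_in J A -> mx_in J B -> mx_in J (A - B).
Proof. by move=> HA HB; apply: mx_inD => //; apply: mx_inN. Qed.

Lemma mx_inZ m n a (A : 'M_(m, n)) : mx_in J A -> mx_in J (a *: A).
Proof. by move=> HA i j; rewrite mxE; apply: ideal_mul. Qed.

Lemma mx_inZl m n a (A : 'M_(m, n)) : J a -> mx_in J (a *: A).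
Proof. by move=> Ja i j; rewrite mxE; apply: ideal_mulr. Qed.

Lemma mx_inMl m n p (A : 'M_(m, n)) (B : 'M_(n, p)) :
  mx_in J A -> mx_in J (A *m B).
Proof. by move=> HA i j; rewrite mxE; apply: ideal_sum => // k _; apply: ideal_mulr. Qed.

Lemma mx_inMr m n p (A : 'M_(m, n)) (B : 'M_(n, p)) :
  mx_in J B -> mx_in J (A *m B).
Proof. by move=> HB i j; rewrite mxE; apply: ideal_sum => // k _; apply: ideal_mul. Qed.

End MatrixIdeal.

Lemma mx_in_zero m n (A : 'M_(m, n)) : mx_in zero_ideal A -> A = 0.
Proof. by move=> HA; apply/matrixP=> i j; rewrite mxE; apply: HA. Qed.

Lemma mx_in_adjoinS J t i m n (A : 'M_(m, n)) :
  mx_in (adjoin J t i.+1) A <-> exists B, mx_in (adjoin J t i) (A - t i *: B).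
Proof.
split=> [HA|[B HB] k l]; last first.
  by exists (B k l); have := HB k l; rewrite !mxE mulrC.
have /fin_all_exists [b Hb] : forall kl : 'I_m * 'I_n, exists b,
    adjoin J t i (A kl.1 kl.2 - b * t i) by move=> kl; apply: HA.
exists (\matrix_(k, l) b (k, l)) => k l.
by rewrite !mxE mulrC; apply: (Hb (k, l)).
Qed.

Lemma mx_in_regular J t h i m n (A : 'M_(m, n)) :
  regular_sequence J t h -> (i < h)%N ->
  mx_in (adjoin J t i) (t i *: A) -> mx_in (adjoin J t i) A.
Proof.
by move=> reg lt_ih HA k l; apply: (reg i lt_ih); have := HA k l; rewrite mxE.
Qed.

End IdealTheory.

Arguments zero_ideal {R} f.

(** * Free resolutions and regular sequences *)

(** A complex [... -> F_1 -> F_0 -> R] of finite free modules, the matrices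
    acting on row vectors.  It carries no grading, since mapping cones are used
    for their exactness and minimality alone. *)
Record free_complex (R : nzRingType) := FreeComplex {
  crank : nat -> nat;
  cdiff : forall i, 'M[R]_(crank i.+1, crank i);
  caug : 'M[R]_(crank 0, 1)
}.
Arguments caug {R} _.

Section Resolutions.
Variable R : comNzRingType.
Implicit Types (J : R -> Prop) (y : nat -> R) (X : free_complex R).

Record resolves J X : Prop := {
  res_surj : forall f, exists v : 'rV_(crank X 0), J (f - (v *m caug X) 0 0);
  res_exact0 : forall v : 'rV_(crank X 0),
    J ((v *m caug X) 0 0) <-> exists w, v = w *m cdiff X 0;
  res_exact : forall i (v : 'rV_(crank X i.+1)),
    v *m cdiff X i = 0 <-> exists w, v = w *m cdiff X i.+1
}.

Section Exactness.
Variables (J : R -> Prop) (X : free_complex R).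
Hypothesis resX : resolves J X.

Lemma cdiff_sq i : cdiff X i.+1 *m cdiff X i = 0.
Proof.
apply/row_matrixP=> k; rewrite row_mul row0.
by apply/(res_exact resX); exists (delta_mx 0 k); rewrite rowE.
Qed.

Lemma caug_cdiff (w : 'rV_(crank X 1)) : J ((w *m cdiff X 0 *m caug X) 0 0).
Proof. by apply/(res_exact0 resX); exists w. Qed.

Lemma res_exact_mx i m (A : 'M_(m, crank X i.+1)) :
  A *m cdiff X i = 0 -> exists B, A = B *m cdiff X i.+1.
Proof.
move=> A0; have /fin_all_exists [b Hb] :
    forall k, exists w, row k A = w *m cdiff X i.+1.
  by move=> k; apply/(res_exact resX); rewrite -row_mul A0 row0.
exists (\matrix_k b k); apply/row_matrixP=> k.
by rewrite row_mul rowK Hb.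
Qed.

(** [Tor_i (R/J, R/(y_0..y_{j-1})) = 0] for [i > j], [y] a regular sequence on
    [R]: a cycle modulo [y_0..y_j] has a boundary that is, modulo
    [y_0..y_{j-1}], the [y_j]-multiple of a cycle one step lower. *)
Lemma tor_vanishing y h : regular_sequence zero_ideal y h ->
  forall j, (j <= h)%N -> forall i, (j <= i)%N -> forall v : 'rV_(crank X i.+1),
  mx_in (adjoin zero_ideal y j) (v *m cdiff X i) ->
  exists w, mx_in (adjoin zero_ideal y j) (v - w *m cdiff X i.+1).
Proof.
move=> reg; elim=> [|j IH] le_jh i le_ji v Hv.
  have /(res_exact resX) [w ->] := mx_in_zero Hv.
  by exists w; rewrite subrr; apply: mx_in0; apply: is_ideal_zero.
case: i le_ji v Hv => // i le_ji v /mx_in_adjoinS [w Hw].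
have idj := is_ideal_adjoin y j (is_ideal_zero R).
have Hwd : mx_in (adjoin zero_ideal y j) (w *m cdiff X i).
  apply: (mx_in_regular reg le_jh); rewrite scalemxAl.
  have := mx_inN idj (mx_inMl idj (cdiff X i) Hw).
  by rewrite mulmxBl -mulmxA cdiff_sq mulmx0 sub0r opprK.
have [w' Hw'] := IH (ltnW le_jh) i le_ji w Hwd.
have [|w'' Hw''] := IH (ltnW le_jh) i.+1 (leqW le_ji) (v - y j *: w').
  rewrite mulmxBl -scalemxAl.
  rewrite -[v *m _](subrK (y j *: w)) -addrA -scalerBr.
  by apply: mx_inD => //; apply: mx_inZ.
by exists w''; apply/mx_in_adjoinS; exists w'; rewrite addrAC.
Qed.

(** An element of [J] acts by zero on [R/J], hence its multiplication on the
    resolution is homotopic to zero; [s] and [s'] are consecutive pieces of a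
    homotopy. *)
Lemma null_homotopy a : J a -> is_ideal J ->
  (exists s, s *m cdiff X 0 = a%:M) /\
  forall i, exists s s',
    cdiff X i *m s + s' *m cdiff X i.+1 = a%:M.
Proof.
move=> Ja idJ.
have [s0 Hs0] : exists s, s *m cdiff X 0 = a%:M.
  have /fin_all_exists [b Hb] :
      forall k, exists w, row k (a%:M : 'M_(crank X 0)) = w *m cdiff X 0.
    move=> k; apply/(res_exact0 resX).
    by rewrite rowE mul_mx_scalar -scalemxAl mxE; apply: ideal_mulr.
  by exists (\matrix_k b k); apply/row_matrixP=> k; rewrite row_mul rowK Hb.
split; first by exists s0.
have step i s : cdiff X i *m s *m cdiff X i = a *: cdiff X i ->
    exists s', cdiff X i *m s + s' *m cdiff X i.+1 = a%:M.
  move=> Hs; have [|s' Hs'] := @res_exact_mx i _ (a%:M - cdiff X i *m s).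
    by rewrite mulmxBl Hs mul_scalar_mx subrr.
  by exists s'; rewrite -Hs' addrC subrK.
(* Knowing [d s d = a d] in one degree is enough to continue the homotopy. *)
have H i : exists s, cdiff X i *m s *m cdiff X i = a *: cdiff X i.
  elim: i => [|i [s Hs]].
    by exists s0; rewrite -mulmxA Hs0 mul_mx_scalar.
  have [s' Hs'] := step i s Hs; exists s'.
  have E : s' *m cdiff X i.+1 = a%:M - cdiff X i *m s.
    by rewrite -Hs' addrC addKr.
  by rewrite -mulmxA; rewrite E mulmxBr mulmxA cdiff_sq mul0mx subr0 mul_mx_scalar.
by move=> i; have [s /step [s' Hs']] := H i; exists s, s'.
Qed.

End Exactness.
End Resolutions.

Section MinimalResolutions.
Variable R : comNzRingType.
Implicit Types (J mm : R -> Prop) (y : nat -> R) (X : free_complex R).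

Definition minimal_over mm X : Prop := forall i, mx_in mm (cdiff X i).

Definition has_zero_column X i : Prop := exists l, col l (cdiff X i) = 0.

(** [Ext^i(R/J, R) = 0] for [i < h] when [J] contains a regular sequence [y] of
    length [h].  The statement modulo [y_0..y_{j-1}] makes the induction on [i]
    work: by [null_homotopy], [y_j] times a cocycle is a coboundary [d w],
    and [w] is a cocycle modulo [y_0..y_j] one step lower. *)
Lemma ext_vanishing J X y h : is_ideal J -> resolves J X ->
  regular_sequence zero_ideal y h -> (forall j, (j < h)%N -> J (y j)) ->
  forall i j, (i + j < h)%N -> forall z : 'cV_(crank X i),
  mx_in (adjoin zero_ideal y j) (cdiff X i *m z) ->
  match i return 'cV_(crank X i) -> Prop with
  | 0 => fun z => mx_in (adjoin zero_ideal y j) z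
  | k.+1 => fun z => exists w, mx_in (adjoin zero_ideal y j) (z - cdiff X k *m w)
  end z.
Proof.
move=> idJ resX reg Jy; elim=> [|i IH] j lt_h z Hz.
  have [[s Hs] _] := null_homotopy resX (Jy _ lt_h) idJ.
  apply: (mx_in_regular reg lt_h); rewrite -mul_scalar_mx -Hs -mulmxA.
  by apply: mx_inMr => //; apply/is_ideal_adjoin/is_ideal_zero.
have lt_jh : (j < h)%N by apply: leq_trans lt_h; rewrite ltnS leq_addl.
have [_ /(_ i) [s [s' Hs]]] := null_homotopy resX (Jy _ lt_jh) idJ.
have idj k := is_ideal_adjoin y k (is_ideal_zero R).
pose w := s *m z.
have Hw : mx_in (adjoin zero_ideal y j) (y j *: z - cdiff X i *m w).
  rewrite -mul_scalar_mx -Hs mulmxDl addrC /w mulmxA addKr -mulmxA.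
  exact: mx_inMr.
have Hdw : mx_in (adjoin zero_ideal y j.+1) (cdiff X i *m w).
  apply/mx_in_adjoinS; exists z.
  by rewrite -opprB; apply: mx_inN.
have {IH Hdw} [b Hb] : exists b,
    mx_in (adjoin zero_ideal y j) (cdiff X i *m w - y j *: (cdiff X i *m b)).
  case: i s s' z Hs w Hw Hdw IH lt_h {Hz} => [|i] s s' z Hs w Hw Hdw IH lt_h.
    have /mx_in_adjoinS [b Hb] := IH j.+1 (ltac:(by rewrite addnS)) w Hdw.
    exists b; rewrite scalemxAr -mulmxBr.
    exact: mx_inMr.
  have [w' /mx_in_adjoinS [b Hb]] := IH j.+1 (ltac:(by rewrite addnS)) w Hdw.
  exists b; rewrite scalemxAr -mulmxBr.
  have := mx_inMr (idj j) (cdiff X i.+1) Hb.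
  by rewrite !mulmxBr mulmxA (cdiff_sq resX) mul0mx subr0.
exists b; apply: (mx_in_regular reg lt_jh).
rewrite scalerBr -[y j *: z](subrK (cdiff X i *m w)) -addrA.
exact: mx_inD.
Qed.

(** A zero column is a basis vector of the dual of [F_i] that is a cocycle, and
    by minimality no basis vector is a coboundary. *)
Lemma no_zero_column J X mm y h i : is_ideal J -> resolves J X ->
  is_ideal mm -> ~ mm 1 -> minimal_over mm X ->
  regular_sequence zero_ideal y h -> (forall j, (j < h)%N -> J (y j)) ->
  (i < h)%N -> ~ has_zero_column X i.
Proof.
move=> idJ resX idm m1 minX reg Jy lt_ih [l Hl].
have := @ext_vanishing J X y h idJ resX reg Jy i 0.
rewrite addn0 => /(_ lt_ih (delta_mx l 0)).
rewrite -colE Hl => /(_ (mx_in0 (is_ideal_zero R) (m := _) (n := _))) {Hl}.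
case: i lt_ih l => [|i] _ l.
  by move/(_ l 0); rewrite mxE !eqxx /= => /eqP; rewrite oner_eq0.
case=> w /mx_in_zero /eqP; rewrite subr_eq0 => /eqP Hw.
apply: m1; have <- : (delta_mx l 0 : 'cV[R]_(crank X i.+1)) l 0 = 1.
  by rewrite mxE !eqxx.
by rewrite Hw; apply: (mx_inMl idm w (minX i)).
Qed.

(** A form of Hilbert's syzygy theorem: [Tor_i(R/J, R/mm)] is the fibre of
    [F_i] at [mm] because the resolution is minimal, and it vanishes for
    [i > h]. *)
Lemma hilbert_syzygy J X mm y h i : resolves J X ->
  is_ideal mm -> ~ mm 1 -> minimal_over mm X ->
  regular_sequence zero_ideal y h ->
  (forall f, mm f <-> adjoin zero_ideal y h f) ->
  (0 < crank X i)%N -> (i <= h)%N.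
Proof.
move=> resX idm m1 minX reg mmE; case: i => // i rk_gt0.
rewrite leqNgt; apply/negP => le_hi; apply: m1.
have [w Hw] := tor_vanishing resX reg (leqnn h) le_hi
  (v := delta_mx 0 (Ordinal rk_gt0))
  (fun k l => (mmE _).1 (mx_inMr idm _ (minX i) k l)).
have := (mmE _).2 (Hw 0 (Ordinal rk_gt0)).
rewrite mxE [X in mm (X + _)]mxE [X in mm (_ + X)]mxE !eqxx /= => Hw1.
by apply: (ideal_eqD idm Hw1); apply: (mx_inMr idm w (minX i.+1)).
Qed.

End MinimalResolutions.

(** * Mapping cones *)

Section Cone.
Variable R : comNzRingType.
Implicit Types (J mm : R -> Prop) (t : nat -> R) (X : free_complex R).

Definition cone X (a : R) : free_complex R :=
  @FreeComplex R
    (fun i => if i is k.+1 then crank X k.+1 + crank X k else crank X 0)%N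
    (fun i => match i return
        'M_(crank X i.+1 + crank X i,
            if i is k.+1 then crank X k.+1 + crank X k else crank X 0) with
      | 0 => col_mx (cdiff X 0) a%:M
      | k.+1 => block_mx (cdiff X k.+1) 0 a%:M (- cdiff X k)
      end)
    (caug X).

Lemma mxDZE m n (A B : 'M[R]_(m, n)) a i j : (A + a *: B) i j = A i j + a * B i j.
Proof. by rewrite mxE [X in _ + X]mxE. Qed.

Lemma mxBZE m n (A B : 'M[R]_(m, n)) a i j : (A - a *: B) i j = A i j - a * B i j.
Proof. by rewrite -scaleNr mxDZE mulNr. Qed.

(** The long exact sequence of the cone has the injective multiplication by [a]
    on [R/J] as its only connecting map. *)
Lemma resolves_cone J X a : is_ideal J -> resolves J X ->
  (forall f, J (a * f) -> J f) ->
  resolves (adjoin J (fun=> a) 1) (cone X a).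
Proof.
move=> idJ resX reg; split=> [f|v|i v] /=.
- have [v Hv] := res_surj resX f; exists v.
  by exists 0; rewrite mul0r subr0.
- split=> [[b Hb]|[w ->]].
    have [v' Hv'] := res_surj resX b.
    have /(res_exact0 resX) [w Hw] : J (((v - a *: v') *m caug X) 0 0).
      rewrite mulmxBl -scalemxAl mxBZE.
      apply: (ideal_eqD idJ (y := (v *m caug X) 0 0 - b * a)) => //.
      rewrite opprB addrC subrKA [b * a]mulrC -mulrBr.
      exact: ideal_mul.
    exists (row_mx w v').
    by rewrite mul_row_col -Hw mul_mx_scalar subrK.
  rewrite -[w]hsubmxK mul_row_col mulmxDl mul_mx_scalar -scalemxAl mxDZE.
  exists ((rsubmx w *m caug X) 0 0).
  rewrite mulrC addrK.
  exact: (caug_cdiff resX).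
(* If [a w] and [u] have opposite boundaries, [u + a w] is a boundary. *)
- have key j (u w : 'rV_(crank X j.+1)) :
      u *m cdiff X j + a *: (w *m cdiff X j) = 0 ->
      exists w', u = w' *m cdiff X j.+1 - a *: w.
    rewrite scalemxAl -mulmxDl => /(res_exact resX) [w' Hw'].
    by exists w'; rewrite -Hw' addrK.
  split.
  + case: i v => [|i] /= v; rewrite -[v]hsubmxK; set u := lsubmx v.
      rewrite mul_row_col mul_mx_scalar => H.
      have /(res_exact0 resX) [w Hw] : J ((rsubmx v *m caug X) 0 0).
        apply: reg; move/(congr1 (fun M => (M *m caug X) 0 0)): H.
        rewrite mulmxDl mul0mx -scalemxAl mxDZE [RHS]mxE.
        move=> /eqP; rewrite addrC addr_eq0 => /eqP ->.
        by apply: (idealN idJ); apply: (caug_cdiff resX).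
      have [|w' Hw'] := key 0%N u w; first by rewrite -Hw.
      exists (row_mx w' (- w)).
      by rewrite mul_row_block mulmx0 add0r !mulNmx mulmxN opprK -Hw
        mul_mx_scalar -Hw'.
    rewrite mul_row_block mulmx0 add0r mul_mx_scalar mulmxN => H.
    have [H1 H2] : u *m cdiff X i.+1 + a *: rsubmx v = 0
                /\ rsubmx v *m cdiff X i = 0.
      have := congr1 lsubmx H; have := congr1 rsubmx H.
      by rewrite row_mxKl row_mxKr !linear0 => /eqP; rewrite oppr_eq0 => /eqP.
    have /(res_exact resX) [w Hw] := H2.
    have [|w' Hw'] := key _ u w; first by rewrite -Hw.
    exists (row_mx w' (- w)).
    by rewrite mul_row_block mulmx0 add0r !mulNmx mulmxN opprK -Hw
      mul_mx_scalar -Hw'.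
  + case=> w ->; rewrite -[w]hsubmxK mul_row_block mulmx0 add0r.
    case: i v w => [|i] v w.
      rewrite mul_row_col mulmxDl -mulmxA (cdiff_sq resX) mulmx0 add0r.
      by rewrite !mul_mx_scalar -scalemxAl mulmxN scalerN addrN.
    rewrite mul_row_block mulmx0 add0r mulmxDl -mulmxA (cdiff_sq resX) mulmx0.
    rewrite add0r !mul_mx_scalar -scalemxAl !mulmxN mulNmx -mulmxA.
    by rewrite (cdiff_sq resX) mulmx0 !oppr0 scalerN addrN row_mx0.
Qed.

Lemma minimal_cone mm X a : is_ideal mm -> mm a ->
  minimal_over mm X -> minimal_over mm (cone X a).
Proof.
move=> idm ma minX.
have ms k : mx_in mm (a%:M : 'M_k).
  by rewrite -scalemx1; apply: mx_inZl.
case=> [|i] k l /=.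
  by case: (split_ordP k) => k' ->; rewrite ?col_mxEu ?col_mxEd; [apply: minX|apply: ms].
case: (split_ordP k) => k' ->; case: (split_ordP l) => l' ->.
- by rewrite block_mxEul; apply: minX.
- by rewrite block_mxEur mxE; apply: ideal0.
- by rewrite block_mxEdl; apply: ms.
- by rewrite block_mxEdr mxE; apply/(idealN idm)/minX.
Qed.

(** In the differential of the cone, only [F_{i+1}] maps to the summand [F_i],
    and it does so by [- d_i]. *)
Lemma zero_column_cone X a i :
  has_zero_column X i -> has_zero_column (cone X a) i.+1.
Proof.
case=> l Hl; exists (rshift _ l) => /=; apply/matrixP=> k j.
rewrite [RHS]mxE mxE; case: (split_ordP k) => k' ->.
  by rewrite block_mxEur mxE.
rewrite block_mxEdr mxE; have /matrixP/(_ k' 0) := Hl.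
by rewrite !mxE => ->; rewrite oppr0.
Qed.

Fixpoint iter_cone X t j :=
  if j is k.+1 then cone (iter_cone X t k) (t k) else X.

Lemma resolves_iter_cone J X t h j : is_ideal J -> resolves J X ->
  regular_sequence J t h -> (j <= h)%N ->
  resolves (adjoin J t j) (iter_cone X t j).
Proof.
move=> idJ resX reg; elim: j => // j IH lt_jh.
exact: (resolves_cone (is_ideal_adjoin t j idJ) (IH (ltnW lt_jh)) (reg j lt_jh)).
Qed.

Lemma minimal_iter_cone mm X t j : is_ideal mm ->
  (forall k, (k < j)%N -> mm (t k)) ->
  minimal_over mm X -> minimal_over mm (iter_cone X t j).
Proof.
move=> idm; elim: j => //= j IH mt minX; apply: minimal_cone => //.
  exact: mt.
by apply: IH => // k lt_kj; apply: mt; apply: leqW.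
Qed.

Lemma zero_column_iter_cone X t i j :
  has_zero_column X i -> has_zero_column (iter_cone X t j) (i + j).
Proof.
move=> H; elim: j => [|j IH]; first by rewrite addn0.
by rewrite addnS; apply: zero_column_cone.
Qed.

Lemma crank_iter_cone X t i j :
  (0 < crank X i)%N -> (0 < crank (iter_cone X t j) (i + j))%N.
Proof.
move=> H; elim: j => [|j IH]; first by rewrite addn0.
by rewrite addnS /= addn_gt0 IH orbT.
Qed.

End Cone.

(** * The correspondence between colon ideals and Tor *)

Section KoszulRelation.
Variable R : comNzRingType.
Variables (J : R -> Prop) (X : free_complex R) (y : nat -> R) (h : nat).
Hypotheses (idJ : is_ideal J) (resX : resolves J X).
Hypothesis reg : regular_sequence zero_ideal y h.
Local Notation p := (adjoin zero_ideal y).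

(** [koszul_rel j f w] says that the class of [w] in [Tor_j(R/p_j, R/J)], the
    homology of [F] modulo [p_j = (y_0..y_{j-1})], corresponds to the class of
    [f] in [(J : p_j)/J] under the isomorphism composed of the [j] connecting
    maps [Tor_{i+1}(R/p_{i+1}, R/J) -> Tor_i(R/p_i, R/J)]. *)
Fixpoint koszul_rel j : R -> 'rV[R]_(crank X j) -> Prop :=
  match j return R -> 'rV[R]_(crank X j) -> Prop with
  | 0 => fun f w => J (f - (w *m caug X) 0 0)
  | k.+1 => fun f v =>
      exists w, koszul_rel f w /\ mx_in (p k) (v *m cdiff X k - y k *: w)
  end.

Let idp j : is_ideal (p j).
Proof. exact/is_ideal_adjoin/is_ideal_zero. Qed.

Lemma koszul_relZ j a f (w : 'rV_(crank X j)) :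
  koszul_rel f w -> koszul_rel (a * f) (a *: w).
Proof.
elim: j w => [|j IH] w /= => [Hw|[v [Hv Hw]]].
  by rewrite -scalemxAl mxE -mulrBr; apply: ideal_mul.
exists (a *: v); split; first exact: IH.
rewrite -scalemxAl scalerA mulrC -scalerA -scalerBr.
exact: (mx_inZ (idp j)).
Qed.

(** The connecting maps are injective, because [tor_vanishing] kills the group
    [Tor_{j+1}(R/p_j, R/J)] that precedes them. *)
Lemma koszul_rel_boundary j f (w : 'rV_(crank X j)) : (j <= h)%N ->
  koszul_rel f w -> (J f <-> exists w', mx_in (p j) (w - w' *m cdiff X j)).
Proof.
elim: j w => [|j IH] w le_jh /= => [Hw|[v [Hv Hw]]].
  have -> : J f <-> J ((w *m caug X) 0 0).
    by split; [apply: ideal_eqDr Hw|apply: ideal_eqD Hw].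
  rewrite (res_exact0 resX); split=> [[w' ->]|[w' /mx_in_zero /eqP]].
    by exists w'; rewrite subrr; exact: (mx_in0 (is_ideal_zero R)).
  by rewrite subr_eq0 => /eqP; exists w'.
rewrite (IH v (ltnW le_jh) Hv); split=> [[v' Hv']|[w' /mx_in_adjoinS [b Hb]]].
  have [|w' Hw'] := tor_vanishing resX reg (ltnW le_jh) (leqnn j) (v := w - y j *: v').
    rewrite mulmxBl -scalemxAl -[w *m _](subrK (y j *: v)) -addrA -scalerBr.
    by apply: (mx_inD (idp j) Hw); apply: (mx_inZ (idp j)).
  by exists w'; apply/mx_in_adjoinS; exists v'; rewrite addrAC.
exists b; apply: (mx_in_regular reg le_jh); rewrite scalerBr.
have := mx_inB (idp j) (mx_inMl (idp j) (cdiff X j) Hb) Hw.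
rewrite !mulmxBl -mulmxA (cdiff_sq resX) mulmx0 subr0 -scalemxAl.
by rewrite opprB addrC subrKA.
Qed.

(** The image of a connecting map is the [y_j]-torsion, so a class lifts once
    more as long as the next [y_j] kills it. *)
Lemma koszul_rel_lift j f : (j <= h)%N ->
  (forall k, (k < j)%N -> J (y k * f)) -> exists w, koszul_rel (j := j) f w.
Proof.
elim: j => [|j IH] le_jh Jf; first exact: (res_surj resX).
have [|w Hw] := IH (ltnW le_jh) => [k lt_kj|]; first exact/Jf/leqW.
have [v Hv] := (koszul_rel_boundary (ltnW le_jh) (koszul_relZ (y j) Hw)).1
  (Jf j (leqnn _)).
by exists v; exists w; split=> //; rewrite -opprB; apply: (mx_inN (idp j)).
Qed.

Lemma koszul_rel_annihilates j f (w : 'rV_(crank X j)) : (j <= h)%N ->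
  koszul_rel f w -> forall k, (k < j)%N -> J (y k * f).
Proof.
move=> le_jh Hw k lt_kj.
apply/(koszul_rel_boundary le_jh (koszul_relZ (y k) Hw)).
exists 0; rewrite mul0mx subr0; apply: (mx_inZl (idp j)).
exact: (adjoin_gen y (is_ideal_zero R)).
Qed.

(** A cycle [w] modulo [p_{j+1}] has boundary [y_j v] modulo [p_j], and
    regularity of [y_j] makes [v] a cycle again: so the descent goes on to [F_0]. *)
Lemma koszul_rel_surj j (w : 'rV_(crank X j)) : (j <= h)%N ->
  match j return 'rV_(crank X j) -> Prop with
  | 0 => fun=> True
  | k.+1 => fun w => mx_in (p k.+1) (w *m cdiff X k)
  end w -> exists f, koszul_rel f w.
Proof.
elim: j w => [|j IH] w le_jh.
  by move=> _; exists ((w *m caug X) 0 0); rewrite /= subrr; apply: ideal0.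
move=> /mx_in_adjoinS [v Hv].
have [|f Hf] := IH v (ltnW le_jh); last by exists f, v.
case: j {IH} w v le_jh Hv => // j w v le_jh Hv.
have /(mx_in_regular reg le_jh) : mx_in (p j.+1) (y j.+1 *: (v *m cdiff X j)).
  have := mx_inN (idp _) (mx_inMl (idp _) (cdiff X j) Hv).
  by rewrite mulmxBl -mulmxA (cdiff_sq resX) mulmx0 sub0r opprK scalemxAl.
by [].
Qed.

End KoszulRelation.

(** * Noetherianity and prime avoidance *)

Lemma exists_min (P : nat -> Prop) : (exists d, P d) -> exists d, is_min P d.
Proof.
case=> d Pd; have exP : exists d, `[< P d >] by exists d; apply/asboolP.
case: (ex_minnP exP) => m /asboolP Pm min_m; exists m; split=> // e Pe.
by apply: min_m; apply/asboolP.
Qed.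

Lemma nondecreasing_subsequence (a : nat -> nat) :
  exists phi : nat -> nat, forall i, (phi i < phi i.+1)%N /\
    (a (phi i) <= a (phi i.+1))%N.
Proof.
have /choice [next Hnext] : forall m, exists r, (m <= r)%N /\
    forall j, (m <= j)%N -> (a r <= a j)%N.
  move=> m.
  have [_ [[i le_mi <-] min_i]] : exists d,
      is_min (fun v => exists2 i, (m <= i)%N & a i = v) d.
    by apply: exists_min; exists (a m), m.
  by exists i; split=> // j le_mj; apply: min_i; exists j.
pose phi := fix phi k := if k is k'.+1 then next (phi k').+1 else next 0%N.
have phi_min k j : (phi k <= j)%N -> (a (phi k) <= a j)%N.
  case: k => [|k] /= le_j; apply: (Hnext _).2 => //.
  exact: leq_trans (Hnext _).1 le_j.
exists phi => i; have lt_i : (phi i < phi i.+1)%N by exact: (Hnext _).1.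
by split=> //; apply: phi_min; apply: ltnW.
Qed.

(** Dickson's lemma: coordinate by coordinate, pass to a subsequence along
    which the exponents are nondecreasing. *)
Lemma dickson n (f : nat -> 'X_{1..n}) :
  exists i j, (i < j)%N /\ (f i <= f j)%MM.
Proof.
have [phi [incr mono]] : exists phi : nat -> nat,
    (forall i, (phi i < phi i.+1)%N) /\
    forall (k : 'I_n) i, (f (phi i) k <= f (phi i.+1) k)%N.
  suff H s : exists phi : nat -> nat,
      (forall i, (phi i < phi i.+1)%N) /\
      forall k : 'I_n, (k < s)%N -> forall i, (f (phi i) k <= f (phi i.+1) k)%N.
    by have [phi [? H']] := H n; exists phi; split=> // k; apply: H'.
  elim: s => [|s [phi [incr mono]]]; first by exists id.
  have [lt_sn|le_ns] := ltnP s n; last first.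
    by exists phi; split=> // k lt_k; apply: mono; apply: leq_trans le_ns.
  pose k0 := Ordinal lt_sn.
  have [psi Hpsi] := nondecreasing_subsequence (fun i => f (phi i) k0).
  have phiW : {homo phi : i j / (i < j)%N} by apply: homo_ltn => //; exact: ltn_trans.
  exists (phi \o psi); split=> [i|k]; first by apply: phiW; case: (Hpsi i).
  rewrite ltnS leq_eqVlt => /orP[/eqP ks|lt_ks] i.
    by rewrite (_ : k = k0); [case: (Hpsi i)|apply: val_inj].
  have /= := @homo_leq _ (fun i => f (phi i) k) leq leqnn (@leq_trans) (mono k lt_ks).
  by apply; apply: ltnW; case: (Hpsi i).
exists (phi 0%N), (phi 1%N); split; first exact: incr.
by apply/mnm_lepP => k; apply: mono.
Qed.

Section Noetherian.
Variables (K : fieldType) (n : nat).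
Local Notation S := {mpoly K[n]}.
Implicit Types (A B J T : S -> Prop).

(** Choose in each [A i.+1] minus [A i] an element [g i] with least leading
    monomial; when that of [g i] divides that of [g j] with [i < j], reducing
    [g j] by [g i] contradicts the choice of [g j]. *)
Lemma noetherian (A : nat -> S -> Prop) : (forall i, is_ideal (A i)) ->
  (forall i f, A i f -> A i.+1 f) -> exists i, forall f, A i.+1 f -> A i f.
Proof.
move=> idA incrA; apply: contrapT => /forallNP noStab.
pose gap i f := A i.+1 f /\ ~ A i f.
have /choice [g Hg] : forall i, exists g, gap i g /\
    forall f, gap i f -> ~ (mlead f < mlead g)%O.
  move=> i.
  have [f0 Hf0] : exists f, gap i f.
    by have /existsNP [f /not_implyP ?] := noStab i; exists f.
  move: f0 Hf0; apply: mleadrect => f0 IH gap0.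
  have [[f [gapf lt_f]]|/forallNP minf0] := EM (exists f, gap i f /\ (mlead f < mlead f0)%O).
    exact: IH lt_f gapf.
  by exists f0; split=> // f gapf lt_f; apply: (minf0 f).
have [i [j [lt_ij le_m]]] := dickson (fun i => mlead (g i)).
have [[gj1 gj0] minj] := Hg j; have [[gi1 _] _] := Hg i.
have {}gi1 : A j (g i).
  rewrite -(subnK lt_ij); elim: (j - i.+1)%N => //= k; exact: incrA.
have gi_neq0 : g i != 0.
  by apply/eqP => gi0; case: (Hg i) => -[_ []]; rewrite gi0; apply: ideal0.
pose c := mleadc (g j) / mleadc (g i).
pose f := g j - c *: 'X_[mlead (g j) - mlead (g i)] * g i.
have leadX : mlead ('X_[mlead (g j) - mlead (g i)] * g i) = mlead (g j).
  rewrite mleadM ?mleadXm ?submK //.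
  by apply/eqP => /(congr1 (mcoeff (mlead (g j) - mlead (g i)))) /eqP;
     rewrite mcoeffX eqxx mcoeff0 oner_eq0.
have gapf : gap j f.
  split.
    by apply: idealB => //; apply: ideal_mul => //; apply: incrA.
  by move=> /(ideal_eqD (idA j)) H; apply: gj0; apply: H; apply: ideal_mul.
apply: (minj f gapf).
have f_neq0 : f != 0 by apply/eqP => f0; case: gapf => _ []; rewrite f0; apply: ideal0.
rewrite lt_neqAle; apply/andP; split.
  apply: contra_neqN f_neq0 => /eqP Hm; apply/eqP; rewrite -mleadc_eq0 Hm.
  have E : ('X_[mlead (g j) - mlead (g i)] * g i)@_(mlead (g j)) = mleadc (g i).
    have := mcoeffMX (g i) (mlead (g j) - mlead (g i)) (mlead (g i)).
    by rewrite submK // mulrC.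
  by rewrite mcoeffB -scalerAl mcoeffZ E /c divfK ?subrr // mleadc_eq0.
have := mleadB_le (g j) (c *: 'X_[mlead (g j) - mlead (g i)] * g i).
move/le_trans; apply; rewrite leUx.
rewrite lexx -scalerAl /=.
by apply: le_trans (mleadZ_le _ _) _; rewrite leadX.
Qed.

Lemma exists_maximal_ideal (Q : (S -> Prop) -> Prop) :
  (forall A, Q A -> is_ideal A) -> (exists A, Q A) ->
  exists A, Q A /\ forall B, Q B -> (forall f, A f -> B f) -> forall f, B f -> A f.
Proof.
move=> idQ [A0 QA0]; apply: contrapT => /forallNP nomax.
have /choice [next Hnext] : forall A : {A | Q A}, exists B : {A | Q A},
    (forall f, sval A f -> sval B f) /\ exists2 f, sval B f & ~ sval A f.
  move=> [A QA] /=.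
  have /not_andP[//|/existsNP [B /not_implyP [QB /not_implyP [AB]]]] := nomax A.
  by move=> /existsPNP [f Bf nAf]; exists (exist _ B QB) => /=; split=> //; exists f.
pose C := fix C k := if k is k'.+1 then next (C k') else exist _ A0 QA0.
have [i Hi] := noetherian (A := fun i => sval (C i))
  (fun i => idQ _ (svalP (C i))) (fun i => (Hnext (C i)).1).
by have [f /Hi] := (Hnext (C i)).2.
Qed.

Definition is_prime (q : S -> Prop) : Prop :=
  [/\ is_ideal q, ~ q 1 & forall u v, q (u * v) -> q u \/ q v].

(** Take an ideal maximal among those containing [J] and disjoint from [T].  If it
    omits [u] and [v], it meets [T] once either is adjoined, and multiplying
    shows that it omits [u v]. *)
Lemma prime_avoidance J T : is_ideal J -> T 1 ->
  (forall u v, T u -> T v -> T (u * v)) -> (forall f, J f -> ~ T f) ->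
  exists q, [/\ is_prime q, forall f, J f -> q f & forall f, q f -> ~ T f].
Proof.
move=> idJ T1 TM JT.
pose Q A := [/\ is_ideal A, forall f, J f -> A f & forall f, A f -> ~ T f].
have [|A [QA maxA]] := @exists_maximal_ideal Q (fun A QA => let: And3 i _ _ := QA in i).
  by exists J.
have [idA JA AT] := QA.
exists A; split=> //; split=> // [A1|u v Auv]; first exact: AT _ A1 T1.
have meet w : ~ A w -> exists a b, A a /\ T (a + b * w).
  move=> nAw; apply: contrapT => H; apply: nAw.
  pose B := adjoin A (fun=> w) 1.
  have idB : is_ideal B := is_ideal_adjoin (fun=> w) 1 idA.
  apply: (maxA B); last by exists 1; rewrite mul1r subrr; apply: ideal0.
    split=> // [f /JA|f [b Ab] Tf]; first exact: adjoin_base.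
    by apply: H; exists (f - b * w), b; rewrite subrK.
  by move=> f; apply: adjoin_base.
have [Au|nAu] := EM (A u); first by left.
have [Av|nAv] := EM (A v); first by right.
have [a [b [Aa Tu]]] := meet u nAu; have [c [d [Ac Tv]]] := meet v nAv.
case: (AT ((a + b * u) * (c + d * v))); last exact: TM.
rewrite mulrDl; apply: idealD => //; first exact: ideal_mulr.
rewrite mulrDr; apply: idealD => //; first exact: ideal_mul.
by rewrite mulrACA; apply: ideal_mul.
Qed.

(** A colon ideal [J : f] that is maximal among the proper ones is prime. *)
Lemma exists_associated_prime J : is_ideal J -> ~ J 1 ->
  exists f, is_prime (fun g => J (g * f)).
Proof.
move=> idJ J1.
have idC f : is_ideal (fun g => J (g * f)).
  split=> [|a x y]; first by rewrite mul0r; apply: ideal0.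
  by rewrite mulrDl -mulrA => Jx Jy; apply: idealD => //; apply: ideal_mul.
pose Q A := exists2 f, ~ J f & A = (fun g => J (g * f)).
have [||_ [[f nJf ->] maxf]] := @exists_maximal_ideal Q.
- by move=> A [f _ ->].
- by exists (fun g => J (g * 1)), 1.
exists f; split=> // [|u v Juv]; first by rewrite mul1r.
have [Ju|nJu] := EM (J (u * f)); [by left|right].
apply: (maxf (fun g => J (g * (u * f)))); first by exists (u * f).
  by move=> g Jg; rewrite mulrCA; apply: ideal_mul.
by rewrite mulrCA mulrA.
Qed.

End Noetherian.

(** * Variables, linear forms and gradings *)

Lemma adjoin_rmorph (R R' : comNzRingType) (phi : {rmorphism R -> R'})
    (y : nat -> R) (y' : nat -> R') j f :
  (forall k, (k < j)%N -> phi (y k) = y' k) ->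
  adjoin zero_ideal y j f -> adjoin zero_ideal y' j (phi f).
Proof.
elim: j f => [|j IH] f Hy /=; first by rewrite /zero_ideal => ->; rewrite rmorph0.
case=> b Hb; exists (phi b); rewrite -Hy // -rmorphM -rmorphB.
by apply: IH Hb => k lt_k; apply/Hy/leqW.
Qed.

Section Coordinates.
Variables (K : fieldType) (n : nat).
Local Notation S := {mpoly K[n]}.
Implicit Types (f g b : S) (m : 'X_{1..n}).

Definition var_power (N i : nat) : S :=
  if insub i is Some k then 'X_k ^+ N else 0.

Definition linear_form (M : 'M[K]_n) (i : nat) : S :=
  if insub i is Some k then \sum_j M k j *: 'X_j else 0.

Lemma mcoeff_mulX b u m :
  (b * 'X_[u])@_m = if (u <= m)%MM then b@_(m - u) else 0.
Proof.
case: ifPn => [le_um|nle_um]; first by rewrite -{1}(submK le_um) addmC mcoeffMX.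
apply/eqP; rewrite mcoeff_eq0; apply: contra nle_um.
by rewrite (perm_mem (msuppMX b u)) => /mapP[m' _ ->]; apply: lem_addr.
Qed.

Lemma le_mul1m (k : 'I_n) N m : (U_(k) *+ N <= m)%MM = (N <= m k)%N.
Proof.
apply/mnm_lepP/idP => [/(_ k)|le_Nm i]; first by rewrite mulmnE mnm1E eqxx mul1n.
by rewrite mulmnE mnm1E; case: eqP => [<-|_]; rewrite ?mul1n ?mul0n.
Qed.

(** Division by [x_k^N], read on coefficients. *)
Lemma split_power (k : 'I_n) N f :
  exists b, forall m, (f - b * 'X_k ^+ N)@_m = if (m k < N)%N then f@_m else 0.
Proof.
elim/mpolyind: f => [|c m0 f _ _ [b Hb]].
  by exists 0 => m; rewrite mul0r subr0 mcoeff0 if_same.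
exists (b + if (m0 k < N)%N then 0 else c *: 'X_[m0 - U_(k) *+ N]) => m.
rewrite [_ *: _ + f]addrC mulrDl opprD addrACA mcoeffD Hb [(f + _)@__]mcoeffD.
have [lt_m0|le_m0] := ltnP (m0 k) N.
  rewrite mul0r subr0 mcoeffZ mcoeffX.
  case: ifP => // nlt_m; case: eqP => [Em|_]; last by rewrite mulr0 addr0.
  by rewrite -Em lt_m0 in nlt_m.
rewrite -scalerAl mpolyXn -mpolyXD submK ?le_mul1m // subrr mcoeff0 addr0.
rewrite mcoeffZ mcoeffX; case: ifP => // lt_m; case: eqP => [Em|_].
  by rewrite -Em ltnNge le_m0 in lt_m.
by rewrite mulr0 addr0.
Qed.

(** Membership in the monomial ideal [(x_0^N, ..., x_{j-1}^N)] is seen on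
    supports, which makes regularity of the sequence [x_i^N] evident. *)
Lemma adjoin_var_power N j f : (j <= n)%N ->
  adjoin zero_ideal (var_power N) j f <->
  forall m, (forall k : 'I_n, (k < j)%N -> (m k < N)%N) -> f@_m = 0.
Proof.
elim: j f => [|j IH] f le_jn.
  split=> [/= -> m _|f0]; first exact: mcoeff0.
  by apply/mpolyP => m; rewrite mcoeff0 f0.
pose k0 := Ordinal le_jn.
have yE : var_power N j = 'X_k0 ^+ N.
  by rewrite /var_power insubT /=; congr ('X__ ^+ N); apply: val_inj.
have lt_small m : (forall k : 'I_n, (k < j.+1)%N -> (m k < N)%N) <->
    (m k0 < N)%N /\ forall k : 'I_n, (k < j)%N -> (m k < N)%N.
  split=> [Hm|[Hm0 Hm] k]; first by split=> [|k lt_k]; apply: Hm => //; apply: leqW.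
  rewrite ltnS leq_eqVlt => /orP[/eqP Ek|]; last exact: Hm.
  by rewrite (_ : k = k0) //; apply: val_inj.
split=> [[b]|Hf].
  rewrite yE => /(IH _ (ltnW le_jn)) Hb m /lt_small [Hm0 Hm].
  have := Hb m Hm; rewrite mcoeffB mpolyXn mcoeff_mulX le_mul1m leqNgt Hm0 /=.
  by rewrite subr0.
have [b Hb] := split_power k0 N f; exists b; rewrite yE.
apply/(IH _ (ltnW le_jn)) => m Hm; rewrite Hb; case: ifP => // lt_m.
by apply: Hf; apply/lt_small.
Qed.

Lemma regular_var_power N : regular_sequence zero_ideal (var_power N) n.
Proof.
move=> i lt_in f; have le_in := ltnW lt_in.
move=> /(adjoin_var_power _ _ le_in) H; apply/(adjoin_var_power _ _ le_in) => m Hm.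
pose k0 := Ordinal lt_in.
have yE : var_power N i = 'X_k0 ^+ N.
  by rewrite /var_power insubT /=; congr ('X__ ^+ N); apply: val_inj.
have := H (U_(k0) *+ N + m)%MM; rewrite yE mulrC mpolyXn mcoeffMX; apply.
move=> k lt_k; rewrite mnmDE mulmnE mnm1E [k0 == k]negbTE ?mul0n ?add0n ?Hm //.
by apply: contraTneq lt_k => <-; rewrite ltnn.
Qed.

Lemma adjoin_all_variables f :
  f@_0%MM = 0 <-> adjoin zero_ideal (var_power 1) n f.
Proof.
rewrite adjoin_var_power //; split=> [f0 m Hm|]; last by apply=> k _; rewrite mnm0E.
rewrite (_ : m = 0%MM) //; apply/mnmP => k; rewrite mnm0E.
by have := Hm k (ltn_ord k); rewrite ltnS leqn0 => /eqP.
Qed.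

Definition constant_free (f : S) : Prop := f@_0%MM = 0.

Lemma is_ideal_constant_free : is_ideal constant_free.
Proof.
split=> [|a x y]; rewrite /constant_free; first exact: mcoeff0.
by move=> x0 y0; rewrite mcoeffD rmorphM /= x0 y0 mulr0 addr0.
Qed.

Lemma constant_free1 : ~ constant_free 1.
Proof. by rewrite /constant_free mcoeff1 eqxx => /eqP; rewrite oner_eq0. Qed.

(** The ideal [(x_0, ..., x_{j-1})] is the kernel of the substitution killing
    these variables, whose target is a domain. *)
Lemma prime_variables j : (j <= n)%N ->
  is_prime (adjoin zero_ideal (var_power 1) j : S -> Prop).
Proof.
move=> le_jn; pose x := var_power 1.
pose tau : S -> S := fun f => f \mPo [tuple if (i < j)%N then 0 else 'X_i | i < n].
have tauX i : tau 'X_i = if (i < j)%N then 0 else 'X_i.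
  by rewrite /tau comp_mpolyXU -tnth_nth tnth_mktuple.
have idj : is_ideal (adjoin zero_ideal x j : S -> Prop).
  exact/is_ideal_adjoin/is_ideal_zero.
have tauE f : adjoin zero_ideal x j f <-> tau f = 0.
  have congr_tau : adjoin zero_ideal x j (f - tau f).
    elim/mpolyind: f => [|c m f _ _ IH]; first by rewrite /tau raddf0 subr0; apply: ideal0.
    rewrite /tau comp_mpolyD comp_mpolyZ -/(tau _) -/(tau f) opprD addrACA -scalerBr.
    apply: idealD => //; rewrite -mul_mpolyC; apply: ideal_mul => //.
    rewrite mpolyXE_id; elim/big_rec: _ => [|i g _ Hg].
      by rewrite /tau rmorph1 subrr; apply: ideal0.
    rewrite {1}/tau rmorphM rmorphXn /= -/(tau _) -/(tau g) tauX.
    have -> (u v : S) : u * g - v * tau g = u * (g - tau g) + (u - v) * tau g.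
      by rewrite mulrBr mulrBl addrA subrK.
    apply: idealD => //; first exact: ideal_mul.
    apply: ideal_mulr => //; case: ifP => lt_ij; last by rewrite subrr; apply: ideal0.
    have Xi : adjoin zero_ideal x j 'X_i.
      have := adjoin_gen x (is_ideal_zero S) lt_ij.
      by rewrite {2}/x /var_power valK expr1.
    case: (m i) => [|e]; first by rewrite !expr0 subrr; apply: ideal0.
    by rewrite expr0n subr0 exprSr; apply: ideal_mul.
  split=> [|f0]; last by move: congr_tau; rewrite f0 subr0.
  have idk : is_ideal (fun f => tau f = 0).
    split=> [|a u v]; first exact: raddf0.
    by rewrite /tau comp_mpolyD rmorphM /= -!/(tau _) => -> ->; rewrite mulr0 addr0.
  apply: (adjoin_sub idk) => [g ->|i lt_ij]; first exact: raddf0.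
  rewrite /x /var_power insubT ?(leq_trans lt_ij) // => lt_in /=.
  by rewrite expr1 tauX /= lt_ij.
split=> // [/tauE|u v /tauE]; first by rewrite /tau rmorph1 => /eqP; rewrite oner_eq0.
rewrite /tau rmorphM /= -!/(tau _) => /eqP; rewrite mulf_eq0.
by case/orP => /eqP /tauE ?; [left|right].
Qed.

Lemma variable_notin j : (j < n)%N ->
  ~ adjoin zero_ideal (var_power 1 : nat -> S) j (var_power 1 j).
Proof.
move=> lt_jn /(adjoin_var_power _ _ (ltnW lt_jn)) /(_ U_(Ordinal lt_jn)%MM).
rewrite /var_power insubT /= expr1 mcoeffX.
rewrite (_ : _ == _); last by apply/eqP; congr U_(_)%MM; apply: val_inj.
move=> H; have /eqP : (1 : K) = 0; last by rewrite oner_eq0.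
apply: H => k lt_k.
by rewrite mnm1E; case: eqP => // Ek; rewrite -Ek ltnn in lt_k.
Qed.

Definition linear_substitution (M : 'M[K]_n) : S -> S :=
  comp_mpoly [tuple \sum_j M i j *: 'X_j | i < n].
HB.instance Definition _ M :=
  GRing.RMorphism.copy (linear_substitution M)
    (comp_mpoly [tuple \sum_j M i j *: 'X_j | i < n]).

Lemma linear_substitutionX M (i : 'I_n) :
  linear_substitution M 'X_i = \sum_j M i j *: 'X_j.
Proof. by rewrite /linear_substitution comp_mpolyXU -tnth_nth tnth_mktuple. Qed.

Lemma linear_substitutionZ M c f :
  linear_substitution M (c *: f) = c *: linear_substitution M f.
Proof. exact: comp_mpolyZ. Qed.

Lemma linear_substitution_var M i :
  linear_substitution M (var_power 1 i) = linear_form M i.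
Proof.
rewrite /var_power /linear_form; case: insubP => [k _ _|_]; last exact: rmorph0.
by rewrite expr1 linear_substitutionX.
Qed.

Lemma linear_substitutionK M M' : M *m M' = 1%:M ->
  cancel (linear_substitution M) (linear_substitution M').
Proof.
move=> MM' f; elim/mpolyind: f => [|c m f _ _ IH]; first by rewrite !rmorph0.
rewrite !rmorphD /= IH !linear_substitutionZ; congr (_ *: _ + _).
rewrite mpolyXE_id; elim/big_rec: _ => [|i g _ Hg]; first by rewrite !rmorph1.
rewrite !rmorphM /= Hg !rmorphXn /= linear_substitutionX; congr (_ ^+ _ * _).
rewrite rmorph_sum /=.
under eq_bigr do rewrite linear_substitutionZ linear_substitutionX scaler_sumr.
rewrite exchange_big /= (eq_bigr (fun k => (M *m M') i k *: 'X_k)) => [|k _].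
  rewrite MM' (bigD1 i) //= big1 => [|k neq_ki].
    by rewrite mxE eqxx scale1r addr0.
  by rewrite mxE eq_sym (negbTE neq_ki) scale0r.
by rewrite mxE scaler_suml; apply: eq_bigr => j _; rewrite scalerA.
Qed.

Section LinearSystem.
Variable M : 'M[K]_n.
Hypothesis unitM : M \in unitmx.
Local Notation sigma := (linear_substitution M).
Local Notation sigma' := (linear_substitution (invmx M)).

Let sigmaK : cancel sigma sigma'.
Proof. by apply: linear_substitutionK; rewrite mulmxV. Qed.
Let sigmaVK : cancel sigma' sigma.
Proof. by apply: linear_substitutionK; rewrite mulVmx. Qed.

(** The automorphism [sigma] carries the variables to the rows of [M] read as
    linear forms, which thereby inherit regularity and primality. *)
Lemma adjoin_linear_form j f :
  adjoin zero_ideal (linear_form M) j (sigma f) <->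
  adjoin zero_ideal (var_power 1) j f.
Proof.
split; last by apply: adjoin_rmorph => k _; rewrite /= linear_substitution_var.
move=> H; rewrite -[f]sigmaK; apply: adjoin_rmorph H => k _ /=.
by rewrite -linear_substitution_var sigmaK.
Qed.

Lemma regular_linear_form : regular_sequence zero_ideal (linear_form M) n.
Proof.
move=> i lt_in f; rewrite -[f]sigmaVK -linear_substitution_var -rmorphM.
by rewrite !adjoin_linear_form; apply: regular_var_power.
Qed.

Lemma prime_linear_form j : (j <= n)%N ->
  is_prime (adjoin zero_ideal (linear_form M) j).
Proof.
move=> le_jn; have [idj nj1 prj] := prime_variables le_jn.
split; first exact/is_ideal_adjoin/is_ideal_zero.
  by rewrite -(rmorph1 sigma) adjoin_linear_form.
move=> u v; rewrite -[u]sigmaVK -[v]sigmaVK -rmorphM !adjoin_linear_form.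
exact: prj.
Qed.

Lemma linear_form_notin j : (j < n)%N ->
  ~ adjoin zero_ideal (linear_form M) j (linear_form M j).
Proof.
by rewrite -linear_substitution_var adjoin_linear_form; apply: variable_notin.
Qed.

End LinearSystem.

Lemma linear_form_homog M i : linear_form M i \is 1.-homog.
Proof.
rewrite /linear_form; case: insubP => [k _ _|_]; last exact: dhomog0.
by apply: rpred_sum => j _; apply: rpredZ; rewrite dhomogX; apply/eqP/mdeg1.
Qed.

Lemma pihomogM_homog d e b f : f \is e.-homog ->
  pihomog mdeg d (b * f) = if (e <= d)%N then pihomog mdeg (d - e) b * f else 0.
Proof.
move=> homf; elim/mpolyind: b => [|c m b _ _ IH].
  by rewrite mul0r !raddf0 mul0r if_same.
rewrite mulrDl raddfD /= IH -scalerAl linearZ /=.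
have homX : 'X_[m] * f \is (mdeg m + e).-homog by apply: dhomogM => //; rewrite dhomogX.
have -> : pihomog mdeg d ('X_[m] * f) =
    if (e <= d)%N then pihomog mdeg (d - e) 'X_[m] * f else 0.
  have [Ed|neq_d] := eqVneq (mdeg m + e)%N d.
    rewrite pihomog_dE -Ed // leq_addl addnK.
    by rewrite [pihomog _ _ 'X_[m]]pihomog_dE // dhomogX.
  rewrite (pihomog_ne0 neq_d homX); case: leqP => // le_ed.
  rewrite pihomogX ifN ?mul0r //; apply: contra neq_d => /eqP ->.
  by rewrite subnK.
case: ifP => _; last by rewrite scaler0 addr0.
by rewrite raddfD /= mulrDl linearZ /= -scalerAl.
Qed.

Lemma adjoin_graded (J : S -> Prop) (t : nat -> S) (i : nat) : is_ideal J ->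
  (forall f d, J f -> J (pihomog mdeg d f)) ->
  (forall j, (j < i)%N -> exists e, t j \is e.-homog) ->
  forall f d, adjoin J t i f -> adjoin J t i (pihomog mdeg d f).
Proof.
move=> idJ grJ; elim: i => //= i IH Ht f d [b Hb].
have [e home] := Ht i (leqnn _).
have := IH (fun j lt_j => Ht j (leqW lt_j)) _ d Hb.
rewrite raddfB /= (pihomogM_homog _ _ home); case: ifP => _ H.
  by exists (pihomog mdeg (d - e) b).
by exists 0; rewrite mul0r.
Qed.

Lemma zero_ideal_graded f d : zero_ideal f -> zero_ideal (pihomog mdeg d f).
Proof. by move=> ->; apply: raddf0. Qed.

Lemma homogeneous_sum f : exists N, f = \sum_(d < N) pihomog mdeg d f.
Proof. by exists (mmeasure mdeg f); apply: pihomog_partitionE. Qed.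

End Coordinates.

(** * Ideals as predicates, and linear primes *)

Section Translation.
Variables (K : fieldType) (n : nat).
Local Notation S := {mpoly K[n]}.
Implicit Types (I p : {pred S}) (J : S -> Prop) (G : S -> Prop).

Definition mem_prop I : S -> Prop := fun f => f \in I.

Lemma is_ideal_mem I : idealr_closed I -> is_ideal (mem_prop I).
Proof. by case=> I0 _ IM; split=> // a x y; apply: IM. Qed.

Lemma proper_mem I : idealr_closed I -> ~ mem_prop I 1.
Proof. by case=> _ /negP. Qed.

Lemma is_prime_mem p : prime_ideal p -> is_prime (mem_prop p).
Proof.
case=> idp prp; split; [exact: is_ideal_mem|exact: proper_mem|].
by move=> u v /prp /orP.
Qed.

Lemma prime_ideal_asbool (q : S -> Prop) :
  is_prime q -> prime_ideal (fun f => `[< q f >]).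
Proof.
case=> [[q0 qM] q1 prq]; split; first split.
- exact/asboolP.
- by apply/asboolP.
- by move=> a x y /asboolP qx /asboolP qy; apply/asboolP/qM.
- by move=> u v /asboolP /prq [] ?; apply/orP; [left|right]; apply/asboolP.
Qed.

Lemma is_ideal_gen G : is_ideal (ideal_gen G).
Proof.
split=> [|a x y [r [c [g [Gg ->]]]] [s [d [h [Gh ->]]]]].
  by exists 0%N, (fun=> 0), (fun=> 0); split=> [[]|] //; rewrite big_ord0.
exists (r + s)%N, (fun k => match split k with inl i => a * c i | inr j => d j end),
  (fun k => match split k with inl i => g i | inr j => h j end).
split=> [k|]; first by case: split.
rewrite big_split_ord /= mulr_sumr; congr (_ + _); apply: eq_bigr => k _.
  by rewrite (unsplitK (inl k)) mulrA.
by rewrite (unsplitK (inr k)).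
Qed.

Lemma mem_ideal_gen G g : G g -> ideal_gen G g.
Proof.
by exists 1%N, (fun=> 1), (fun=> g); split=> //; rewrite big_ord1 mul1r.
Qed.

Lemma ideal_gen_sub G J : is_ideal J -> (forall g, G g -> J g) ->
  forall f, ideal_gen G f -> J f.
Proof.
move=> idJ GJ _ [r [a [g [Gg ->]]]]; apply: ideal_sum => // k _.
by apply: ideal_mul => //; apply: GJ.
Qed.

Lemma ideal_adjoinE I t i f : is_ideal (mem_prop I) ->
  ideal_adjoin I t i f <-> adjoin (mem_prop I) t i f.
Proof.
move=> idI; split.
  apply: ideal_gen_sub => [|g [If|[j lt_ji ->]]].
  - exact: is_ideal_adjoin.
  - exact: adjoin_base.
  - exact: adjoin_gen.
apply: adjoin_sub => [|g Ig|j lt_ji]; first exact: is_ideal_gen.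
  by apply: mem_ideal_gen; left.
by apply: mem_ideal_gen; right; exists j.
Qed.

Definition vector_form (v : 'rV[K]_n) : S := \sum_j v 0 j *: 'X_j.

Lemma vector_formD u v : vector_form (u + v) = vector_form u + vector_form v.
Proof. by rewrite -big_split; apply: eq_bigr => j _; rewrite mxE scalerDl. Qed.

Lemma vector_formZ c v : vector_form (c *: v) = c *: vector_form v.
Proof. by rewrite scaler_sumr; apply: eq_bigr => j _; rewrite mxE scalerA. Qed.

Lemma homog1_vector_form (g : S) :
  g \is 1.-homog -> g = vector_form (\row_j g@_U_(j)).
Proof.
move=> homg; apply/mpolyP => m; rewrite raddf_sum /=.
under eq_bigr do rewrite mcoeffZ mcoeffX mxE.
have [/mdeg1P [k /eqP ->]|neq1] := boolP (mdeg m == 1%N).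
  rewrite (bigD1 k) //= eqxx mulr1 big1 ?addr0 // => j neq_jk.
  by rewrite eq_mnm1 (negbTE neq_jk) mulr0.
rewrite (dhomog_nemf_coeff homg neq1) big1 // => j _.
by case: eqP => [Em|]; rewrite ?mulr0 //; rewrite -Em mdeg1 in neq1.
Qed.

(** The coefficient vectors of the linear forms in [p] make up a subspace.  It is
    the row space of a matrix [W] of maximal rank among those with row space in
    it, and the first [\rank W] rows of [row_ebase W] are a basis of it. *)
Lemma linear_forms_basis p : is_ideal (mem_prop p) -> generated_by_linear_forms p ->
  exists (M : 'M[K]_n) (h : nat), [/\ M \in unitmx, (h <= n)%N &
    forall f, f \in p <-> adjoin zero_ideal (linear_form M) h f].
Proof.
move=> idp [G [homG pE]].
pose inp (A : 'M[K]_n) := forall v : 'rV_n, (v <= A)%MS -> vector_form v \in p.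
have exr : exists r, `[< exists2 A, inp A & \rank A = r >].
  exists 0%N; apply/asboolP; exists 0; last exact: mxrank0.
  move=> v; rewrite submx0 => /eqP ->; rewrite /vector_form big1; first exact: (ideal0 idp).
  by move=> j _; rewrite mxE scale0r.
have [|r /asboolP [W inW rankW] max_r] := ex_maxnP exr (m := n).
  by move=> r /asboolP [A _ <-]; apply: rank_leq_col.
have WE v : vector_form v \in p -> (v <= W)%MS.
  move=> pv; apply: contrapT => /negP nvW.
  have lt_W : (W < W + v)%MS.
    by rewrite ltmxE addsmxSl /= addsmx_sub submx_refl.
  have := rank_ltmx lt_W; rewrite rankW ltnNge max_r //.
  apply/asboolP; exists (W + v)%MS => //.
  move=> u /sub_addsmxP [[a b] /= ->]; rewrite vector_formD.
  apply: (idealD idp); first by apply/inW/submxMl.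
  have -> : b *m v = b 0 0 *: v.
    by rewrite [b]mx11_scalar mul_scalar_mx mxE eqxx.
  by rewrite vector_formZ -mul_mpolyC; apply: (ideal_mul idp).
pose M := row_ebase W; exists M, (\rank W); split; first exact: row_ebase_unit.
  exact: rank_leq_col.
have rowM (i : 'I_(\rank W)) (k : 'I_n) : k = i :> nat -> row k M = row i (row_base W).
  move=> Eki; apply/rowP => j; rewrite !mxE (bigD1 k) //= big1 => [|k' neq_k'].
    by rewrite mxE Eki eqxx ltn_ord mul1r addr0.
  by rewrite mxE -Eki eq_sym (inj_eq val_inj) (negbTE neq_k') mul0r.
have formM (i : 'I_(\rank W)) : linear_form M i = vector_form (row i (row_base W)).
  have lt_in := leq_trans (ltn_ord i) (rank_leq_col W).
  rewrite -(rowM i (Ordinal lt_in)) // /linear_form insubT /=.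
  by apply: eq_bigr => j _; rewrite mxE; congr (M _ _ *: _); apply: val_inj.
have idl : is_ideal (adjoin zero_ideal (linear_form M) (\rank W)).
  exact/is_ideal_adjoin/is_ideal_zero.
move=> f; split; last first.
  apply: (adjoin_sub idp) => [g ->|j lt_j]; first exact: (ideal0 idp).
  rewrite (formM (Ordinal lt_j)); apply: inW.
  by rewrite -(eq_row_base W); apply: row_sub.
move/pE; apply: (ideal_gen_sub idl) => g Gg.
have /homog1_vector_form Eg := homG g Gg.
have : vector_form (\row_j g@_U_(j)) \in p by rewrite -Eg; apply/pE/mem_ideal_gen.
move/WE; rewrite -(eq_row_base W) => /submxP [a Ea].
rewrite Eg Ea mulmx_sum_row.
elim/big_ind: _ => [|u v Hu Hv|i _].
- rewrite /vector_form big1; first exact: ideal0.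
  by move=> j _; rewrite mxE scale0r.
- by rewrite vector_formD; apply: idealD.
- rewrite vector_formZ -mul_mpolyC -formM; apply: ideal_mul => //.
  exact: (adjoin_gen _ (is_ideal_zero _) (ltn_ord i)).
Qed.

(** Being generated by forms, [p] annihilates modulo [I] every component [f_d] of
    a witness [f].  If each [f_d] had an annihilator outside [p], their product
    would annihilate [f]. *)
Lemma homogeneous_witness I p : graded_ideal I -> associated_prime I p ->
  generated_by_linear_forms p ->
  exists d, exists2 f : S, f \is d.-homog & colon I f =i p.
Proof.
move=> [idI grI] [prp [f fE]] [G [homG pE]].
have {}idI := is_ideal_mem idI.
have [_ p1 primep] := is_prime_mem prp.
have idC g : is_ideal (mem_prop (colon I g)).
  split=> [|a x y]; rewrite /mem_prop !inE; first by rewrite mul0r; apply: (ideal0 idI).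
  by rewrite mulrDl -mulrA => Ix Iy; apply: (idealD idI) => //; apply: (ideal_mul idI).
have sub_p d g : g \in p -> g \in colon I (pihomog mdeg d f).
  move/pE; apply: (ideal_gen_sub (idC _)) => l Gl.
  have : l \in colon I f by rewrite fE; apply/pE/mem_ideal_gen.
  rewrite /mem_prop !inE => /(grI _ d.+1).
  by rewrite mulrC (pihomogM_homog _ _ (homG l Gl)) /= subn1 mulrC.
have [[d Hd]|/forallNP nosub] :=
    EM (exists d, forall g, g \in colon I (pihomog mdeg d f) -> g \in p).
  exists d, (pihomog mdeg d f); first exact: pihomogP.
  by move=> g; apply/idP/idP; [apply: Hd|apply: sub_p].
have /choice [a Ha] : forall d, exists g, g \in colon I (pihomog mdeg d f) /\ g \notin p.
  move=> d; have /existsNP [g /not_implyP [Hg /negP Hg']] := nosub d.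
  by exists g.
have [N fN] := homogeneous_sum f.
have : \prod_(d < N) a d \in colon I f.
  rewrite inE [in X in _ * X]fN mulr_sumr; apply: (ideal_sum idI) => d _.
  rewrite (bigD1 d) //= mulrAC; apply: (ideal_mulr idI).
  by case: (Ha d).
rewrite fE; elim/big_rec: _ => [|d g _ IH /primep []] //.
by rewrite /mem_prop => pa; case: (Ha d) => _; rewrite pa.
Qed.

Lemma monomial_support I : is_ideal (mem_prop I) -> monomial_ideal I ->
  forall f, f \in I -> forall m, m \in msupp f -> 'X_[m] \in I.
Proof.
move=> idI [Mon IE] f /IE.
apply: (ideal_gen_sub (J := fun f => forall m, m \in msupp f -> 'X_[m] \in I)).
  split=> [m|a x y Hx Hy m]; first by rewrite msupp0.
  move/msuppD_le; rewrite mem_cat => /orP[/msuppM_le|]; last exact: Hy.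
  case/allpairsP => -[m1 m2] /= [_ /Hx H2 ->].
  by rewrite mpolyXD; apply: (ideal_mul idI).
move=> _ [m Mm ->] m'; rewrite msuppX inE => /eqP ->.
by apply/IE/mem_ideal_gen; exists m.
Qed.

Definition drop_lead (f : S) : S := f - mleadc f *: 'X_[mlead f].

Lemma mlead_drop_lead f : drop_lead f != 0 -> (mlead (drop_lead f) < mlead f)%O.
Proof.
move=> nz; rewrite lt_neqAle; apply/andP; split.
  apply: contra_neqN nz => /eqP Em; apply/eqP; rewrite -mleadc_eq0 Em.
  by rewrite mcoeffB mcoeffZ mcoeffX eqxx mulr1 subrr.
apply: le_trans (mleadB_le _ _) _; rewrite leUx lexx /=.
by apply: le_trans (mleadZ_le _ _) _; rewrite mleadXm.
Qed.

(** The leading term of [g f] lies in [I], so multiplying by the leading monomial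
    of [g] disposes of the leading term of [f]; the other terms of [f] follow by
    induction.  The factor ['X_[u]] keeps track of the multiplications made. *)
Lemma lead_power_colon I g : is_ideal (mem_prop I) -> monomial_ideal I ->
  g != 0 -> forall f u, g * ('X_[u] * f) \in I ->
  exists k, 'X_[mlead g] ^+ k * ('X_[u] * f) \in I.
Proof.
move=> idI monI nzg f; elim/mleadrect: f => f IH u Igf.
have [->|nzf] := eqVneq f 0; first by exists 0%N; rewrite !mulr0; apply: (ideal0 idI).
have nzX m : 'X_[m] != 0 :> S.
  by apply/eqP => /(congr1 (mcoeff m)) /eqP; rewrite mcoeffX eqxx mcoeff0 oner_eq0.
have Ilead : 'X_[mlead g] * ('X_[u] * 'X_[mlead f]) \in I.
  rewrite -!mpolyXD; apply: (monomial_support idI monI Igf).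
  have nzuf : 'X_[u] * f != 0 by rewrite mulf_neq0.
  have <- : mlead (g * ('X_[u] * f)) = (mlead g + (u + mlead f))%MM.
    by rewrite !mleadM // mleadXm.
  by rewrite mlead_supp // mulf_neq0.
have fE : f = mleadc f *: 'X_[mlead f] + drop_lead f.
  by rewrite /drop_lead addrC subrK.
have Ig' : g * ('X_[mlead g + u] * drop_lead f) \in I.
  have -> : g * ('X_[mlead g + u] * drop_lead f) = 'X_[mlead g] * (g * ('X_[u] * f))
      - (mleadc f *: g) * ('X_[mlead g] * ('X_[u] * 'X_[mlead f])).
    by rewrite /drop_lead mpolyXD -!mul_mpolyC; ring.
  by apply: (idealB idI); apply: (ideal_mul idI).
have [E0|nz0] := eqVneq (drop_lead f) 0.
  exists 1%N; rewrite fE E0 addr0 expr1 -!scalerAr -mul_mpolyC.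
  exact: (ideal_mul idI).
have [k Hk] := IH _ (mlead_drop_lead nz0) _ Ig'.
exists k.+1.
have -> : 'X_[mlead g] ^+ k.+1 * ('X_[u] * f) =
    (mleadc f *: 'X_[mlead g] ^+ k) * ('X_[mlead g] * ('X_[u] * 'X_[mlead f]))
    + 'X_[mlead g] ^+ k * ('X_[mlead g + u] * drop_lead f).
  by rewrite /drop_lead mpolyXD exprSr -!mul_mpolyC; ring.
by apply: (idealD idI) => //; apply: (ideal_mul idI).
Qed.

(** With [g], the prime contains the leading monomial of [g] by
    [lead_power_colon], hence all its monomials, and with a monomial one of its
    variables. *)
Lemma monomial_associated_prime I p : is_ideal (mem_prop I) -> monomial_ideal I ->
  associated_prime I p -> generated_by_linear_forms p.
Proof.
move=> idI monI [prp [f fE]].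
have [idp p1 primep] := is_prime_mem prp.
have prime_exp g k : g ^+ k \in p -> g \in p.
  by elim: k => [|k IH] //; rewrite exprS => /primep [].
have monp g : g \in p -> forall m, m \in msupp g -> 'X_[m] \in p.
  elim/mleadrect: g => g IH pg m m_g.
  have [g0|nzg] := eqVneq g 0; first by rewrite g0 msupp0 in m_g.
  have plead : 'X_[mlead g] \in p.
    have Igf : g * ('X_[0] * f) \in I by rewrite mpolyX0 mul1r; have := pg; rewrite -fE.
    have [k] := lead_power_colon idI monI nzg Igf.
    rewrite mpolyX0 mul1r => Hk; apply: (@prime_exp _ k).
    by rewrite -fE inE.
  have [->|neq_m] := eqVneq m (mlead g); first by [].
  have m_d : m \in msupp (drop_lead g).
    rewrite mcoeff_msupp mcoeffB mcoeffZ mcoeffX [mlead g == m]eq_sym (negbTE neq_m) mulr0 subr0.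
    by rewrite -mcoeff_msupp.
  have nzd : drop_lead g != 0 by apply: contraTneq m_d => ->; rewrite msupp0.
  apply: IH (mlead_drop_lead nzd) _ _ m_d.
  by apply: (idealB idp) => //; rewrite -mul_mpolyC; apply: (ideal_mul idp).
exists (fun g => exists2 i, g = 'X_i & 'X_i \in p); split=> [_ [i -> _]|g].
  by rewrite dhomogX; apply/eqP/mdeg1.
split=> [pg|]; last by apply: (ideal_gen_sub idp) => _ [i -> pi].
rewrite [g]mpolyE big_seq; apply: (ideal_sum (is_ideal_gen _)) => m m_g.
rewrite -mul_mpolyC; apply: (ideal_mul (is_ideal_gen _)).
have [i pi mi] : exists2 i, 'X_i \in p & m i != 0%N.
  have := monp g pg m m_g; rewrite mpolyXE_id.
  apply: contraPP => /forall2NP noi.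
  elim/big_rec: _ => [|i x _ IH /primep [pi|]] //.
  case: (noi i) => [|/negP]; first by case; apply: (@prime_exp _ (m i)).
  rewrite negbK => /eqP mi; apply: p1.
  by have := pi; rewrite mi expr0.
rewrite -[m](@submK _ U_(i)) ?lep1mP // mpolyXD; apply: (ideal_mul (is_ideal_gen _)).
by apply: mem_ideal_gen; exists i.
Qed.

End Translation.

(** * Chains of primes and the Artinian reduction *)

Section PrimeChains.
Variables (K : fieldType) (n : nat).
Local Notation S := {mpoly K[n]}.
Implicit Types (I : {pred S}) (J q : S -> Prop).

(** Chains of primes with their largest term [q] made explicit, so that they can
    be continued upwards. *)
Definition chain_to J d q : Prop := exists Q : nat -> S -> Prop,
  [/\ Q d = q, forall i, (i <= d)%N -> is_prime (Q i) /\ (forall f, J f -> Q i f)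
    & forall i, (i < d)%N ->
        (forall f, Q i f -> Q i.+1 f) /\ exists2 f, Q i.+1 f & ~ Q i f].

Lemma chain_to0 J q : is_prime q -> (forall f, J f -> q f) -> chain_to J 0 q.
Proof. by move=> prq Jq; exists (fun=> q); split=> // i; rewrite leqn0. Qed.

Lemma chain_toS J d q q' : chain_to J d q -> is_prime q' ->
  (forall f, q f -> q' f) -> (exists2 f, q' f & ~ q f) -> chain_to J d.+1 q'.
Proof.
move=> [Q [Qd prQ incQ]] prq' qq' [f q'f nqf].
exists (fun i => if (i <= d)%N then Q i else q'); split=> [|i le_i|i].
- by rewrite ltnn.
- case: leqP => [/prQ //|_]; split=> // g Jg; apply: qq'.
  by rewrite -Qd; have [_] := prQ d (leqnn d); apply.
- move=> le_id; have [->|lt_id] := eqVneq i d.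
    by rewrite leqnn ltnn Qd; split=> //; exists f.
  have {}lt_id : (i < d)%N by rewrite ltn_neqAle lt_id.
  by rewrite (ltnW lt_id) lt_id; apply: incQ.
Qed.

Lemma prime_chain_to I d q : chain_to (mem_prop I) d q -> prime_chain I d.
Proof.
move=> [Q [_ prQ incQ]]; exists (fun i f => `[< Q i f >]).
split=> i Hi; [have [prq IQ] := prQ i Hi|have [QQ [f Qf nQf]] := incQ i Hi].
  by split=> [|f If]; [apply: prime_ideal_asbool|apply/asboolP/IQ].
split=> [g /asboolP Qg|/(_ f) E]; first exact/asboolP/QQ.
by apply/nQf/asboolP; move: E; rewrite /in_mem /= => ->; apply/asboolP.
Qed.

(** The chain consists of the primes [(l_0, ..., l_{j-1})] for [h <= j <= n]. *)
Lemma linear_prime_chain J (M : 'M[K]_n) h : M \in unitmx -> (h <= n)%N ->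
  (forall f, J f -> adjoin zero_ideal (linear_form M) h f) ->
  exists q, chain_to J (n - h) q.
Proof.
move=> unitM le_hn Jp.
suff H d : (h + d <= n)%N -> chain_to J d (adjoin zero_ideal (linear_form M) (h + d)).
  by exists (adjoin zero_ideal (linear_form M) (h + (n - h))); apply: H; rewrite subnKC.
elim: d => [|d IH] le_n.
  by rewrite addn0; apply: chain_to0 => //; apply: prime_linear_form.
have lt_n : (h + d < n)%N by rewrite -addnS.
rewrite addnS; apply: chain_toS (IH (ltnW lt_n)) _ _ _.
- exact: prime_linear_form.
- by move=> f; apply: adjoinS; apply: is_ideal_zero.
- exists (linear_form M (h + d)); last exact: linear_form_notin.
  exact: (adjoin_gen _ (is_ideal_zero _)).
Qed.

(** Each member of a regular sequence allows a further step down: the products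
    [s t_i^k] with [s] outside [q] avoid [(J, t_0, ..., t_{i-1})]. *)
Lemma regular_sequence_chain J (t : nat -> S) d : is_ideal J ->
  regular_sequence J t d -> forall i, (i <= d)%N -> forall q, is_prime q ->
  (forall f, adjoin J t i f -> q f) -> chain_to J i q.
Proof.
move=> idJ reg; elim=> [|i IH] le_id q prq Jq; first exact: chain_to0.
have [idq q1 primeq] := prq.
have qt : q (t i) by apply/Jq/adjoin_gen.
pose T f := exists s k, ~ q s /\ f = s * t i ^+ k.
have [||f Jf [s [k [nqs Ef]]]|q' [prq' Jq' q'T]] :=
    @prime_avoidance K n (adjoin J t i) T (is_ideal_adjoin t i idJ).
- by exists 1, 0%N; rewrite mulr1.
- move=> u v [s [k [nqs ->]]] [s' [k' [nqs' ->]]].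
  exists (s * s'), (k + k')%N; split; last by rewrite mulrACA exprD.
  by case/primeq.
- apply: nqs; apply/Jq/adjoinS => //; move: Jf; rewrite {f}Ef.
  elim: k => [|k IHk]; first by rewrite mulr1.
  by rewrite exprS mulrCA => /(reg i le_id).
apply: chain_toS (IH (ltnW le_id) q' prq' Jq') prq _ _ => [f q'f|].
  by apply: contrapT => nqf; apply: (q'T f q'f); exists f, 0%N; rewrite mulr1.
by exists (t i) => // /q'T; apply; exists 1, 1%N; rewrite mul1r.
Qed.

Definition graded_part q : S -> Prop := fun f => forall d, q (pihomog mdeg d f).

(** If [u_a] and [v_b] are the components of lowest degree outside [q], then
    [u_a v_b] is the only term outside [q] in the component of degree [a + b] of
    [u v]. *)
Lemma prime_graded_part q : is_prime q -> is_prime (graded_part q).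
Proof.
move=> [idq q1 primeq].
have pihomogM N d (u v : S) : (d < N)%N -> (mmeasure mdeg u <= N)%N ->
    pihomog mdeg d (u * v) =
    \sum_(i < N | (i <= d)%N) pihomog mdeg i u * pihomog mdeg (d - i) v.
  move=> lt_dN le_uN; rewrite {1}(pihomog_partitionE le_uN) mulr_suml raddf_sum /=.
  rewrite [RHS]big_mkcond; apply: eq_bigr => i _; rewrite mulrC.
  by rewrite (pihomogM_homog _ _ (pihomogP _ _ _)); case: ifP => // _; rewrite mulrC.
split; first split.
- by move=> d; rewrite raddf0; apply: ideal0.
- move=> a x y qx qy d; rewrite raddfD /=; apply: idealD => //.
  rewrite (pihomogM (maxn d.+1 (mmeasure mdeg a))) ?leq_maxl ?leq_maxr //.
  by apply: ideal_sum => // i _; apply: ideal_mul.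
- by move=> /(_ 0%N); rewrite pihomog_dE ?dhomog1.
move=> u v quv; apply: contrapT => /not_orP [/existsNP exu /existsNP exv].
have [a [nqa mina]] := exists_min exu; have [b [nqb minb]] := exists_min exv.
have := quv (a + b)%N; pose N := maxn (a + b).+1 (mmeasure mdeg u).
have lt_aN : (a < N)%N by rewrite leq_max ltnS leq_addr.
rewrite (pihomogM N) ?leq_maxl ?leq_maxr // (bigD1 (Ordinal lt_aN)) ?leq_addr //=.
rewrite addKn => qsum.
have : q (pihomog mdeg a u * pihomog mdeg b v).
  apply: (ideal_eqD idq (y := - \sum_(i < N | (i <= a + b)%N && (i != Ordinal lt_aN))
    pihomog mdeg i u * pihomog mdeg (a + b - i) v)); first by rewrite opprK.
  apply: idealN => //; apply: ideal_sum => // i /andP[le_i neq_i].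
  have [lt_ia|le_ai] := ltnP i a.
    apply: ideal_mulr => //; apply: contrapT => /mina.
    by rewrite leqNgt lt_ia.
  apply: ideal_mul => //; apply: contrapT => /minb.
  have lt_ai : (a < i)%N by rewrite ltn_neqAle le_ai andbT eq_sym.
  lia.
by case/primeq.
Qed.

Lemma prime_constant_free : is_prime (@constant_free K n).
Proof.
split; [exact: is_ideal_constant_free|exact: constant_free1|].
move=> u v; rewrite /constant_free rmorphM /= => /eqP.
by rewrite mulf_eq0 => /orP[] /eqP; [left|right].
Qed.

Lemma pihomog0_constant (f : S) : pihomog mdeg 0 f = (f@_0%MM)%:MP.
Proof.
elim/mpolyind: f => [|c m f _ _ IH]; first by rewrite raddf0 mcoeff0 mpolyC0.
rewrite raddfD /= linearZ /= IH mcoeffD mpolyCD; congr (_ + _).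
rewrite pihomogX mdeg_eq0 mcoeffZ mcoeffX; case: eqP => [->|_].
  by rewrite mulr1 mpolyX0 -mul_mpolyC mulr1.
by rewrite mulr0 scaler0.
Qed.

(** Otherwise a prime over [(I, t)] avoids some variable.  From its graded part
    one can descend [d] times along the regular sequence and ascend once more, to
    the irrelevant ideal, which makes a chain longer than the dimension. *)
Lemma artinian_reduction I (t : nat -> S) d :
  graded_ideal I -> is_krull_dim I d -> regular_sequence (mem_prop I) t d ->
  (forall i, (i < d)%N -> exists e, t i \is e.-homog) ->
  exists N, forall k, (k < n)%N -> adjoin (mem_prop I) t d (var_power K n N k).
Proof.
move=> [idI grI] [_ maxd] reg homt.
have {}idI := is_ideal_mem idI.
have idJ := is_ideal_adjoin t d idI.
suff /fin_all_exists [N HN] : forall k : 'I_n, exists N, adjoin (mem_prop I) t d ('X_k ^+ N).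
  exists (\max_k N k) => k lt_kn; rewrite /var_power insubT /=.
  rewrite -(subnK (leq_bigmax (Ordinal lt_kn))) exprD.
  exact: (ideal_mul idJ).
move=> k; apply: contrapT => /forallNP noN.
have [|||q [prq Jq qT]] :=
    @prime_avoidance K n _ (fun f => exists N, f = 'X_k ^+ N) idJ.
- by exists 0%N.
- by move=> u v [N ->] [N' ->]; exists (N + N')%N; rewrite exprD.
- by move=> f Jf [N Ef]; apply: (noN N); rewrite -Ef.
have [idq q1 _] := prq.
suff : prime_chain I d.+1 by move/maxd; rewrite ltnn.
apply: (@prime_chain_to _ _ (@constant_free K n)).
apply: (@chain_toS _ _ (graded_part q)).
- apply: regular_sequence_chain reg _ (leqnn d) _ (prime_graded_part prq) _ => //.
  move=> f Jf e; apply: Jq.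
  by apply: adjoin_graded => // g e'; apply: grI.
- exact: prime_constant_free.
- move=> f /(_ 0%N); rewrite pihomog0_constant => qf.
  apply: contrapT => /eqP nz; apply: q1.
  by rewrite -mpolyC1 -(mulVf nz) mpolyCM; apply: ideal_mul.
exists 'X_k; first by rewrite /constant_free mcoeffX mnm1_eq0.
move=> /(_ 1%N); rewrite pihomog_dE => [/qT|]; last by rewrite dhomogX; apply/eqP/mdeg1.
by apply; exists 1%N.
Qed.

End PrimeChains.

(** * The minimal resolution of a Cohen-Macaulay ring *)

Lemma no_ord m : m = 0%N -> 'I_m -> False.
Proof. by move=> -> []. Qed.

Section Resolution.
Variables (K : fieldType) (n : nat).
Local Notation S := {mpoly K[n]}.
Variables (I : {pred S}) (F : graded_free_seq K n).
Hypotheses (HI : graded_ideal I) (HF : minimal_graded_free_resolution I F).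
Implicit Types (p : {pred S}).
Local Notation c := (flen F).

Let idI : is_ideal (mem_prop I). Proof. by apply: is_ideal_mem; case: HI. Qed.
Let properI : ~ mem_prop I 1. Proof. by apply: proper_mem; case: HI. Qed.

Definition ungraded : free_complex S :=
  FreeComplex (fun i => fdiff F i) (faug F).

Lemma resolves_ungraded : resolves (mem_prop I) ungraded.
Proof.
by split; [exact: (mres_aug_surj HF)|exact: (mres_exact0 HF)|exact: (mres_exact HF)].
Qed.

Lemma minimal_ungraded : minimal_over (@constant_free K n) ungraded.
Proof. by move=> i k l; apply: (mres_minimal HF). Qed.

Lemma frank0_gt0 : (0 < frank F 0)%N.
Proof.
rewrite lt0n; apply/eqP => F0; have [v] := mres_aug_surj HF 1.
rewrite mxE big1 ?subr0 => [|k _]; first exact: properI.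
by case: (no_ord F0 k).
Qed.

Lemma homog_constant_free e (f : S) : (0 < e)%N -> f \is e.-homog -> constant_free f.
Proof.
move=> e_gt0 homf; apply: (dhomog_nemf_coeff homf).
by rewrite /= mdeg0 eq_sym -lt0n.
Qed.

Lemma homog0_constant (f : S) : f \is 0.-homog -> f = (f@_0%MM)%:MP.
Proof. by move=> homf; rewrite -pihomog0_constant pihomog_dE. Qed.

Section RegularSequence.
Variables (t : nat -> S) (d : nat).
Hypothesis homt : forall i, (i < d)%N -> exists2 e, (0 < e)%N & t i \is e.-homog.
Hypothesis regt : regular_sequence (mem_prop I) t d.

Let cft i : (i < d)%N -> constant_free (t i).
Proof. by move/homt => [e]; apply: homog_constant_free. Qed.

(** The inequality of the Auslander-Buchsbaum formula that bounds [c] from above: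
    the iterated cone is a minimal resolution of length [c + d], and such a
    length is at most [n]. *)
Lemma flen_add_depth : (c + d <= n)%N.
Proof.
have res := resolves_iter_cone idI resolves_ungraded regt (leqnn d).
have minX := minimal_iter_cone (is_ideal_constant_free K n) cft minimal_ungraded.
apply: (hilbert_syzygy res (is_ideal_constant_free K n) (@constant_free1 K n) minX
  (@regular_var_power K n 1)) => [f|].
  exact: adjoin_all_variables.
by apply: crank_iter_cone; apply: (mres_len HF).
Qed.

(** A trace of the vanishing of [Ext^i(S/I, S)] for [i < c].  A zero column of
    [F] at [i] would give one at [i + d < n] in the iterated cone, which resolves
    an Artinian quotient, that is, one by an ideal containing the regular
    sequence [x_k^N] of length [n]. *)
Lemma no_zero_column_below : is_krull_dim I d -> (c + d)%N = n ->
  forall i, (i < c)%N -> ~ has_zero_column ungraded i.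
Proof.
move=> dimI Ecd i lt_ic zero_col.
have [N HN] : exists N, forall k, (k < n)%N ->
    adjoin (mem_prop I) t d (var_power K n N k).
  by apply: artinian_reduction => // k /homt [e]; exists e.
have res := resolves_iter_cone idI resolves_ungraded regt (leqnn d).
have minX := minimal_iter_cone (is_ideal_constant_free K n) cft minimal_ungraded.
have lt_n : (i + d < n)%N by rewrite -Ecd ltn_add2r.
apply: (no_zero_column (is_ideal_adjoin t d idI) res (is_ideal_constant_free K n)
  (@constant_free1 K n) minX (@regular_var_power K n N) HN lt_n).
exact: zero_column_iter_cone.
Qed.

End RegularSequence.

Lemma cohen_macaulay_data : cohen_macaulay I -> exists t d,
  [/\ is_krull_dim I d, regular_sequence (mem_prop I) t d
    & forall i, (i < d)%N -> exists2 e, (0 < e)%N & t i \is e.-homog].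
Proof.
case=> d [[t [homt regt _]] _] dimI; exists t, d; split=> // i lt_id f.
by rewrite -!ideal_adjoinE //; apply: regt.
Qed.

(** * Degree shifts and regularity *)

Section Shifts.
Hypothesis noZ : forall i, (i < c)%N -> ~ has_zero_column ungraded i.

(** A nonzero entry in the column [l] has positive degree, by minimality. *)
Lemma fshift_grows i (l : 'I_(frank F i)) : (i < c)%N ->
  exists k : 'I_(frank F i.+1), (fshift F l < fshift F k)%N.
Proof.
move=> lt_ic; apply: contrapT => /forallNP no_k; apply: (noZ lt_ic).
exists l; apply/matrixP => k j; rewrite !mxE; apply: contrapT => /eqP nz.
have [e Ek home] := mres_diff_homog HF nz; apply: (no_k k); rewrite Ek.
case: e home {Ek} => [|e] home; last by rewrite addnS ltnS leq_addr.
by move: nz; rewrite (homog0_constant home) (mres_minimal HF) mpolyC0 eqxx.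
Qed.

Variable s : nat.
Hypothesis shift_c : forall k : 'I_(frank F c), fshift F k = s.

Lemma fshift_bound i (l : 'I_(frank F i)) : (i <= c)%N ->
  (fshift F l + (c - i) <= s)%N.
Proof.
move=> le_ic; move Em : (c - i)%N => m.
elim: m i l le_ic Em => [|m IH] i l le_ic Em.
  have Eic : i = c by apply/eqP; rewrite eqn_leq le_ic -subn_eq0 Em.
  by move: l; rewrite Eic => l; rewrite shift_c addn0.
have lt_ic : (i < c)%N by rewrite -subn_gt0 Em.
have [k lt_k] := fshift_grows l lt_ic.
have := IH _ k lt_ic; rewrite subnS Em => /(_ erefl); apply: leq_trans.
by rewrite addnS -addSn leq_add2r.
Qed.

Lemma flen_le_shift : (c <= s)%N.
Proof.
have := fshift_bound (Ordinal frank0_gt0) (leq0n c).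
by rewrite subn0; apply: leq_trans; apply: leq_addl.
Qed.

(** Since the shifts grow at each step, the maximum of [j - i] is attained at the
    end of the resolution. *)
Lemma regularityE : regularity F = (s - c)%N.
Proof.
apply/eqP; rewrite eqn_leq; apply/andP; split.
  apply/bigmax_leqP => i _; apply/bigmax_leqP => j /eqP/eqP.
  rewrite /betti -lt0n => /card_gt0P [k]; rewrite inE => /eqP <-.
  have := fshift_bound k (ltn_ord i : (i <= c)%N).
  have := ltn_ord i; rewrite ltnS; lia.
pose k := Ordinal (mres_len HF).
apply: leq_trans (leq_bigmax (ord_max : 'I_c.+1)).
have lt_s : (s < (\max_(k < frank F c) fshift F k).+1)%N.
  by rewrite ltnS -(shift_c k); apply: leq_bigmax.
apply: leq_trans (@leq_bigmax_cond _ _ _ (Ordinal lt_s) _) => //.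
rewrite /betti -lt0n; apply/card_gt0P; exists k.
by rewrite inE shift_c.
Qed.

End Shifts.

(** Coboundaries vanish at the origin by minimality, so a family generating the
    canonical module spans the fibre at the origin of the dual of [F_c]. *)
Lemma ext_generated_fibre m (x : 'I_m -> 'cV[S]_(frank F c)) J :
  ext_generated x J -> forall k : 'I_(frank F c), exists a : 'I_m -> K, forall l,
  \sum_(j in J) a j * (x j l 0)@_0%MM = (l == k)%:R.
Proof.
case=> _ gen k; have Fc0 : frank F c.+1 = 0%N by apply: (mres_finite HF).
have [|a Ha] := gen (delta_mx k 0).
  by apply/matrixP => i; case: (no_ord Fc0 i).
exists (fun j => (a j)@_0%MM) => l.
have cob : forall i (z : 'cV_(frank F i)) (l : 'I_(frank F i)),
    ext_coboundary z -> constant_free (z l 0).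
  case=> [|i] z l' /= => [->|[y ->]]; first by rewrite mxE; apply: mcoeff0.
  exact: (mx_inMl (is_ideal_constant_free K n) y (@minimal_ungraded i) l' 0).
have := cob _ _ l Ha; rewrite /constant_free !mxE mcoeffB summxE raddf_sum /=.
move/eqP; rewrite subr_eq0 eqxx andbT => /eqP H; symmetry.
transitivity ((((l == k)%:R : S))@_0%MM).
  by case: (l == k); rewrite ?mcoeff1 ?eqxx ?mcoeff0.
rewrite H; apply: eq_bigr => j _; rewrite mxE; exact: rmorphM.
Qed.

(** Some generator has an entry not vanishing at the origin in the position [k];
    this entry has degree 0, so the degree of the generator is [- fshift F k]. *)
Lemma level_shift : level I F -> exists s, forall k : 'I_(frank F c), fshift F k = s.
Proof.
case=> _ [m [x [d [gen _ homx]]]]; exists `|d|%N => k.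
have [a Ha] := ext_generated_fibre gen k.
have : (\sum_(j in setT) a j * (x j k 0)@_0%MM) != 0 by rewrite Ha eqxx oner_eq0.
apply: contraNeq => neq; apply/eqP; apply: big1 => j _.
have [->|nz] := eqVneq (x j k 0) 0; first by rewrite mcoeff0 mulr0.
have [e Ee home] := homx j k nz.
suff -> : (x j k 0)@_0%MM = 0 by rewrite mulr0.
apply: (@homog_constant_free e) home; rewrite lt0n; apply: contra_neq neq => e0.
by move: Ee; rewrite e0; lia.
Qed.

Lemma gorenstein_frank : gorenstein I F -> forall k l : 'I_(frank F c), k = l.
Proof.
case=> _ [x gen] k l; apply/eqP.
have [a Ha] := ext_generated_fibre gen k; have [b Hb] := ext_generated_fibre gen l.
have sum1 (e : 'I_1 -> K) i : \sum_(j in [set: 'I_1]) e j * (x j i 0)@_0%MM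
    = e 0 * (x 0 i 0)@_0%MM.
  by rewrite (bigD1 0) ?inE //= big1 ?addr0 // => j; rewrite [j]ord1 eqxx andbF.
apply: contrapT => /negP neq_kl.
have := Ha l; rewrite sum1 eq_sym (negbTE neq_kl) => /eqP; rewrite mulf_eq0.
case/orP => /eqP E; [have := Ha k|have := Hb l]; rewrite sum1 E eqxx ?mul0r ?mulr0.
  by move=> /eqP; rewrite eq_sym oner_eq0.
by move=> /eqP; rewrite eq_sym oner_eq0.
Qed.

(** * Homogeneous components of the Koszul correspondence *)

(** The component of degree [e] in the graded module
    [F_i = \bigoplus_k S(- fshift k)]. *)
Definition hom_part e i (v : 'rV[S]_(frank F i)) : 'rV[S]_(frank F i) :=
  \row_k if (fshift F k <= e)%N then pihomog mdeg (e - fshift F k) (v 0 k) else 0.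

Lemma hom_partB e i (u v : 'rV_(frank F i)) :
  hom_part e (u - v) = hom_part e u - hom_part e v.
Proof.
apply/rowP => k; rewrite !mxE; case: ifP => _; last by rewrite subrr.
by rewrite raddfB.
Qed.

Lemma hom_partZ e i (a : S) (v : 'rV_(frank F i)) : a \is 1.-homog ->
  hom_part e.+1 (a *: v) = a *: hom_part e v.
Proof.
move=> homa; apply/rowP => k; rewrite !mxE.
have [le_k|lt_k] := leqP (fshift F k) e.
  rewrite leqW // mulrC (pihomogM_homog _ _ homa) subn_gt0 ltnS le_k.
  by rewrite subnAC subn1 mulrC.
rewrite mulr0; case: ifP => // le_k1.
rewrite mulrC (pihomogM_homog _ _ homa) ifN //.
by rewrite subn_gt0 ltnS -ltnNge.
Qed.

Lemma hom_part_diff e i (v : 'rV_(frank F i.+1)) :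
  hom_part e (v *m fdiff F i) = hom_part e v *m fdiff F i.
Proof.
apply/rowP => l; transitivity (\sum_k if (fshift F l <= e)%N
    then pihomog mdeg (e - fshift F l) (v 0 k * fdiff F i k l) else 0).
  by rewrite !mxE; case: ifP => _; [rewrite raddf_sum|rewrite big1].
rewrite mxE; apply: eq_bigr => k _; rewrite mxE.
have [->|nz] := eqVneq (fdiff F i k l) 0; first by rewrite !mulr0 raddf0 if_same.
have [q -> homq] := mres_diff_homog HF nz.
rewrite (pihomogM_homog _ _ homq) subnDA.
have -> : (fshift F l + q <= e)%N = (fshift F l <= e)%N && (q <= e - fshift F l)%N.
  by apply/idP/andP => [|[]]; lia.
case: (fshift F l <= e)%N => /=; last by rewrite mul0r.
by case: ifP => // _; rewrite mul0r.
Qed.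

Lemma hom_part_aug e (v : 'rV_(frank F 0)) :
  pihomog mdeg e ((v *m faug F) 0 0) = (hom_part e v *m faug F) 0 0.
Proof.
rewrite !mxE raddf_sum /=; apply: eq_bigr => k _; rewrite mxE.
rewrite (pihomogM_homog _ _ (mres_aug_homog HF k)).
by case: ifP => // _; rewrite mul0r.
Qed.

Section LinearPrime.
Variables (M : 'M[K]_n).
Hypothesis unitM : M \in unitmx.
Local Notation l := (linear_form M).
Local Notation p_ := (adjoin zero_ideal l).
Local Notation rel := (koszul_rel (mem_prop I) (X := ungraded) l).

Lemma linear_form_graded j f d : p_ j f -> p_ j (pihomog mdeg d f).
Proof.
apply: adjoin_graded; [exact: is_ideal_zero|exact: zero_ideal_graded|].
by move=> i _; exists 1%N; apply: linear_form_homog.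
Qed.

Lemma koszul_rel_hom_part j d f (w : 'rV_(frank F j)) :
  rel f w -> rel (pihomog mdeg d f) (hom_part (d + j) w).
Proof.
elim: j f w => [|j IH] f w /=.
  by rewrite addn0 -hom_part_aug -raddfB; case: HI => _; apply.
case=> v [Hv Hw]; exists (hom_part (d + j) v); split; first exact: IH.
rewrite addnS -hom_part_diff -hom_partZ ?linear_form_homog // -hom_partB.
move=> i k; rewrite mxE; case: ifP => _; last first.
  exact: (ideal0 (is_ideal_adjoin l j (is_ideal_zero S))).
by apply: linear_form_graded.
Qed.

(** If [F_i] has rank one, [u] lies outside the prime [p_i] and [u d] has its
    entries in [p_i], then so does [d]. *)
Lemma generator_cycle i f (w : 'rV_(frank F i)) k0 : (i <= n)%N ->
  (forall k k' : 'I_(frank F i), k = k') -> rel f w -> ~ p_ i (w 0 k0) ->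
  match i return 'rV_(frank F i) -> Prop with
  | 0 => fun=> True
  | j.+1 => fun v => mx_in (p_ j.+1) (v *m fdiff F j)
  end (const_mx 1).
Proof.
case: i w k0 => // j w k0 le_jn rk1 [v [_ Hv]] nw i k.
have mulE (u : 'rV_(frank F j.+1)) i' :
    (u *m fdiff F j) i' k = u i' k0 * fdiff F j k0 k.
  rewrite mxE (bigD1 k0) //= big1 ?addr0 // => k' /eqP neq_k'.
  by case: neq_k'; apply: rk1.
rewrite mulE mxE mul1r.
have [_ _ primep] := prime_linear_form unitM le_jn.
have : p_ j.+1 (w 0 k0 * fdiff F j k0 k).
  by rewrite -mulE; exists (v 0 k); have := Hv 0 k; rewrite mxBZE mulrC.
by case/primep.
Qed.

Variables (p : {pred S}) (h : nat).
Hypotheses (le_hn : (h <= n)%N) (pE : forall f, f \in p <-> p_ h f).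
Hypothesis prp : prime_ideal p.

Let regl : regular_sequence zero_ideal l h.
Proof. by move=> i lt_ih; apply: regular_linear_form => //; apply: leq_trans le_hn. Qed.

Let idp j : is_ideal (p_ j). Proof. exact/is_ideal_adjoin/is_ideal_zero. Qed.

Let p1 : ~ p_ h 1.
Proof. by move/pE; apply: proper_mem; case: prp. Qed.

Lemma annihilated f : colon I f =i p -> forall k, (k < h)%N -> mem_prop I (l k * f).
Proof.
move=> fE k lt_kh; have : l k \in p by apply/pE/adjoin_gen => //; apply: is_ideal_zero.
by rewrite -fE inE.
Qed.

Lemma colon_proper f : colon I f =i p -> ~ mem_prop I f.
Proof.
move=> fE If; apply: p1; apply/pE; rewrite -fE inE mul1r; exact: If.
Qed.

(** Beyond the length of [F] the correspondence would identify the class of [f]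
    in [(I : p)/I], which is nonzero, with an element of a zero group. *)
Lemma height_le_flen f : colon I f =i p -> (h <= c)%N.
Proof.
move=> fE; rewrite leqNgt; apply/negP => lt_ch.
have [w Hw] := koszul_rel_lift idI resolves_ungraded regl (leqnn h) (annihilated fE).
apply: (colon_proper fE).
apply/(koszul_rel_boundary idI resolves_ungraded regl (leqnn h) Hw).
by exists 0 => i k; case: (no_ord (mres_finite HF lt_ch) k).
Qed.

Hypothesis Ehc : h = c.

Lemma last_boundary (w : 'rV_(frank F c.+1)) : w *m fdiff F c = 0.
Proof.
apply/matrixP => i k; rewrite !mxE big1 // => j _.
by case: (no_ord (mres_finite HF (leqnn _)) j).
Qed.

Lemma last_class f (w : 'rV_(frank F c)) : rel f w ->
  (mem_prop I f <-> mx_in (p_ h) w).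
Proof.
move=> Hw; rewrite (koszul_rel_boundary idI resolves_ungraded regl _ Hw) Ehc //.
split=> [[w']|Hp]; first by rewrite [w' *m _]last_boundary subr0.
by exists 0; rewrite [0 *m _]last_boundary subr0.
Qed.

Lemma last_lift f : colon I f =i p -> exists w : 'rV_(frank F c), rel f w.
Proof.
move=> fE; apply: (koszul_rel_lift idI resolves_ungraded regl); first by rewrite Ehc.
by rewrite -Ehc; apply: annihilated.
Qed.

Variable s : nat.
Hypothesis shift_c : forall k : 'I_(frank F c), fshift F k = s.

(** The class of [f] corresponds to a nonzero element of degree [d + c] in
    [F_c / p F_c], and the latter vanishes in degrees below [s]. *)
Lemma shift_le_degree d f : f \is d.-homog -> colon I f =i p -> (s <= d + c)%N.
Proof.
move=> homf fE; have [w /(koszul_rel_hom_part d)] := last_lift fE.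
rewrite pihomog_dE // => Hw; rewrite leqNgt; apply/negP => lt_s.
apply: (colon_proper fE); apply/(last_class Hw) => i k.
by rewrite mxE shift_c leqNgt lt_s /=; apply: ideal0.
Qed.

(** The element of [F_c = S(-s)] corresponding to [f] lies outside [p].  By
    [generator_cycle] the generator of [F_c], of degree [s], is then a cycle
    modulo [p] as well, so it corresponds to some [g], of degree [s - c].  Here
    [I : g = p], because [a] times the generator lies in [p F_c] only for [a] in
    [p]. *)
Lemma gorenstein_witness f : (forall k k' : 'I_(frank F c), k = k') -> (c <= s)%N ->
  colon I f =i p ->
  exists2 g : S, g \is (s - c).-homog & colon I g =i p.
Proof.
move=> rk1 le_cs fE; have [w Hw] := last_lift fE.
have [_ _ primep] := is_prime_mem prp.
pose k0 := Ordinal (mres_len HF).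
have pcE x : p_ c x <-> p_ h x by rewrite Ehc.
have nw : ~ p_ c (w 0 k0).
  move=> /pcE pw; apply: (colon_proper fE); apply/(last_class Hw) => i k.
  by rewrite [i]ord1 (rk1 k k0).
have [g Hg] : exists g, rel g (const_mx 1 : 'rV_(frank F c)).
  apply: (koszul_rel_surj idI resolves_ungraded regl); first by rewrite Ehc.
  apply: (generator_cycle _ rk1 Hw nw).
  by rewrite -Ehc.
exists (pihomog mdeg (s - c) g); first exact: pihomogP.
have {Hg} := koszul_rel_hom_part (s - c) Hg; rewrite subnK //.
have -> : hom_part s (const_mx 1 : 'rV_(frank F c)) = const_mx 1.
  apply/rowP => k; rewrite !mxE shift_c leqnn subnn.
  by rewrite pihomog_dE // dhomog1.
set g' := pihomog _ _ _ => Hg a; apply/idP/idP.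
  rewrite inE => /(last_class (koszul_relZ idI a Hg)) /(_ 0 k0).
  by rewrite !mxE mulr1 => /pE.
move=> /pE; rewrite inE.
apply: (@adjoin_sub _ zero_ideal (fun a => mem_prop I (a * g'))).
- split=> [|x y z Iy Iz]; first by rewrite mul0r; apply: ideal0.
  by rewrite mulrDl -mulrA; apply: (idealD idI) => //; apply: (ideal_mul idI).
- by move=> _ ->; rewrite mul0r; apply: ideal0.
- rewrite Ehc; apply: (koszul_rel_annihilates idI resolves_ungraded regl _ Hg).
  by rewrite Ehc.
Qed.

End LinearPrime.
End Resolution.

(** * The v-number *)

Section VNumber.
Variables (K : fieldType) (n : nat).
Local Notation S := {mpoly K[n]}.
Variables (I : {pred S}) (F : graded_free_seq K n).
Hypotheses (HI : graded_ideal I) (HF : minimal_graded_free_resolution I F).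
Implicit Types (p : {pred S}).

(** All dimensions agree: [height p <= c] because [p] is associated,
    [c <= n - depth] by the syzygy theorem, and [n - dim <= height p]. *)
Lemma cohen_macaulay_linear_prime p : cohen_macaulay I -> associated_prime I p ->
  generated_by_linear_forms p ->
  (forall i, (i < flen F)%N -> ~ has_zero_column (ungraded F) i) /\
  exists M : 'M[K]_n, [/\ M \in unitmx, (flen F <= n)%N
    & forall f, f \in p <-> adjoin zero_ideal (linear_form M) (flen F) f].
Proof.
move=> CM assp linp; have [prp [f0 f0E]] := assp.
have [t [d [dimI regt homt]]] := cohen_macaulay_data HI CM.
have [[idp _ _] idI] := (is_prime_mem prp, is_ideal_mem HI.1).
have [M [h [unitM le_hn pE]]] := linear_forms_basis idp linp.
have le_hc := height_le_flen HI HF unitM le_hn pE prp f0E.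
have le_n := flen_add_depth HI HF homt regt.
have [|q chain] := @linear_prime_chain K n (mem_prop I) M h unitM le_hn.
  by move=> f If; apply/pE; rewrite -f0E inE mulrC; apply: (ideal_mul idI).
have le_d : (n - h <= d)%N by apply: dimI.2; apply: prime_chain_to chain.
have Ehc : h = flen F by lia.
split; first by apply: (no_zero_column_below HI HF homt regt dimI); lia.
by exists M; rewrite -Ehc.
Qed.

Lemma exists_local_vnumber p : associated_prime I p -> generated_by_linear_forms p ->
  exists v, is_local_vnumber I p v.
Proof. by move=> assp linp; apply/exists_min/homogeneous_witness. Qed.

Lemma level_vnumber p : associated_prime I p -> generated_by_linear_forms p ->
  level I F -> forall v, is_local_vnumber I p v -> (regularity F <= v)%N.
Proof.
move=> assp linp lev v [[f homf fE] _].
have [noZ [M [unitM le_cn pE]]] := cohen_macaulay_linear_prime lev.1 assp linp.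
have [s shift_c] := level_shift HF lev.
rewrite (regularityE HF noZ shift_c) leq_subLR addnC.
exact: (shift_le_degree HI HF unitM le_cn pE assp.1 (erefl _) shift_c homf fE).
Qed.

Lemma gorenstein_vnumber p : associated_prime I p -> generated_by_linear_forms p ->
  gorenstein I F -> is_local_vnumber I p (regularity F).
Proof.
move=> assp linp gor.
have [noZ [M [unitM le_cn pE]]] := cohen_macaulay_linear_prime gor.1 assp linp.
have rk1 := gorenstein_frank HF gor.
pose s := fshift F (Ordinal (mres_len HF)).
have shift_c (k : 'I_(frank F (flen F))) : fshift F k = s by rewrite (rk1 k (Ordinal (mres_len HF))).
have le_cs := flen_le_shift HI HF noZ shift_c.
rewrite (regularityE HF noZ shift_c); split.
  have [_ [f0 f0E]] := assp.
  exact: (gorenstein_witness HI HF unitM le_cn pE assp.1 (erefl _) shift_c rk1 le_cs f0E).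
move=> e [f homf fE]; rewrite leq_subLR addnC.
exact: (shift_le_degree HI HF unitM le_cn pE assp.1 (erefl _) shift_c homf fE).
Qed.

Lemma exists_associated : exists p, associated_prime I p.
Proof.
have [f [idf f1 prf]] := exists_associated_prime (is_ideal_mem HI.1) (proper_mem HI.1).
exists (colon I f); split; last by exists f.
split; last by move=> u v /prf /orP.
by case: idf => f0 fM; split=> //; apply/negP.
Qed.

End VNumber.

Theorem theorem1 (K : fieldType) (n : nat) (I : {pred {mpoly K[n]}})
    (F : graded_free_seq K n)
    (HI : graded_ideal I) (HF : minimal_graded_free_resolution I F) :
  (forall p : {pred {mpoly K[n]}},
     associated_prime I p -> generated_by_linear_forms p ->
     (gorenstein I F -> is_local_vnumber I p (regularity F)) /\
     (level I F ->
        exists2 v : nat, is_local_vnumber I p v & (regularity F <= v)%N)) /\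
  ((forall p : {pred {mpoly K[n]}},
      associated_prime I p -> generated_by_linear_forms p) ->
     (gorenstein I F -> is_vnumber I (regularity F)) /\
     (level I F -> exists2 v : nat, is_vnumber I v & (regularity F <= v)%N)) /\
  (monomial_ideal I ->
     forall p : {pred {mpoly K[n]}},
       associated_prime I p -> generated_by_linear_forms p).
Proof.
split; [|split].
- move=> p assp linp; split; first exact: gorenstein_vnumber.
  move=> lev; have [v Hv] := exists_local_vnumber HI assp linp.
  by exists v => //; exact: (level_vnumber HI HF assp linp lev Hv).
- move=> lin; have [p assp] := exists_associated HI; split.
    move=> gor; split; first by exists p => //; apply: gorenstein_vnumber (lin p assp) gor.
    move=> e [p' assp' [Hp' _]].
    by have [_ minr] := gorenstein_vnumber HI HF assp' (lin p' assp') gor; apply: minr.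
  move=> lev; have [v0 Hv0] := exists_local_vnumber HI assp (lin p assp).
  have [v Hv] : exists v, is_vnumber I v by apply: exists_min; exists v0, p.
  exists v => //; have [[p' assp' Hp'] _] := Hv.
  exact: (level_vnumber HI HF assp' (lin p' assp') lev Hp').
- by move=> monI p; apply: monomial_associated_prime => //; apply: is_ideal_mem HI.1.
Qed.
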